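(* Let $P$ be the uniform distribution on the closed unit disc $D=\{(x_1,x_2)\in\mathbb R^2: x_1^2+x_2^2\le 1\}$. Assume that every optimal set of six-means for $P$ is either the vertex set of a regular hexagon centered at the origin, or consists of the origin together with the vertices of a regular pentagon centered at the origin. Then there are uncountably many optimal sets of six-means for $P$, the quantization error is $V_6(P)=0.093595$ (decimal approximation, i.e. $|V_6(P)-0.093595|<10^{-6}$), and there is a number $c$ with $|c-0.470361|<10^{-6}$ such that, for any optimal set of six-means, one of the six points is the center of the disc and the other five form a regular pentagon inscribed in the circle $x_1^2+x_2^2=c$.
   Context: The uniform distribution on $D$ is the Borel probability measure with density $\frac1\pi$ on $D$ and $0$ elsewhere with respect to Lebesgue measure. For a Borel probability measure $P$ on $\mathbb R^d$ and $n\ge1$, the $n$th quantization error is $V_n(P)=\inf\{\int \min_{a\in\alpha}\|x-a\|^2\,dP(x):\alpha\subset\mathbb R^d,\ \mathrm{card}(\alpha)\le n\}$, where $\|\cdot\|$ is the Euclidean norm. A set $\alpha$ with $\mathrm{card}(\alpha)\le n$ attaining the infimum is called an optimal set of $n$-means; for absolutely continuous $P$ it has exactly $n$ elements. *)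

(* Defs.v *)
From HB Require Import structures.
From mathcomp Require Import all_boot all_order all_algebra.
From mathcomp Require Import all_classical all_reals all_analysis.
Set Implicit Arguments.
Unset Strict Implicit.
Unset Printing Implicit Defensive.
Import Order.TTheory GRing.Theory Num.Theory.
Import numFieldNormedType.Exports.
Local Open Scope classical_set_scope.
Local Open Scope card_scope.
Local Open Scope ring_scope.

(* measurableTypeR R is R with its Borel sigma-algebra, so plane R is R * R with
   the Borel sigma-algebra of R^2. *)
Notation plane R := (measurableTypeR R * measurableTypeR R)%type.

(* The squared Euclidean distance; the library norm on R * R is the max norm. *)
Definition sqdist (R : realType) (x y : R * R) : R :=
  (x.1 - y.1) ^+ 2 + (x.2 - y.2) ^+ 2.

Definition unit_disc (R : realType) : set (R * R) :=
  [set x | x.1 ^+ 2 + x.2 ^+ 2 <= 1].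

Definition is_uniform_disc (R : realType)
    (P : probability (plane R) R) : Prop :=
  forall A : set (plane R), measurable A ->
    P A = (\int[(@lebesgue_measure R) \x (@lebesgue_measure R)]_(x in A)
             (pi^-1 * \1_(@unit_disc R) x)%:E)%E.

(* For a finite nonempty alpha the infimum is the minimum over alpha; for an
   empty alpha it is +oo. *)
Definition distortion (R : realType) (P : probability (plane R) R)
    (alpha : set (R * R)) : \bar R :=
  (\int[P]_x ereal_inf [set (sqdist x a)%:E | a in alpha])%E.

Definition quantization_error (R : realType) (P : probability (plane R) R)
    (n : nat) : \bar R :=
  ereal_inf [set distortion P alpha | alpha in
              [set alpha : set (R * R) | alpha #<= `I_n]].

Definition optimal_means (R : realType) (P : probability (plane R) R)
    (n : nat) (alpha : set (R * R)) : Prop :=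
  alpha #<= `I_n /\ distortion P alpha = quantization_error P n.

(* Vertex set of the regular n-gon with centre o and circumradius r > 0, one of
   whose vertices lies in direction t from o. *)
Definition ngon (R : realType) (n : nat) (o : R * R) (r t : R) : set (R * R) :=
  [set (o.1 + r * cos (t + 2 * pi * k%:R / n%:R),
        o.2 + r * sin (t + 2 * pi * k%:R / n%:R)) | k in `I_n].

Definition regular_ngon_centered (R : realType) (n : nat) (o : R * R)
    (A : set (R * R)) : Prop :=
  exists r t : R, 0 < r /\ A = ngon n o r t.

Definition regular_ngon (R : realType) (n : nat) (A : set (R * R)) : Prop :=
  exists o : R * R, regular_ngon_centered n o A.

(* c is the squared radius. *)
Definition circle_sq (R : realType) (c : R) : set (R * R) :=
  [set x | x.1 ^+ 2 + x.2 ^+ 2 = c].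

(* Main.v *)
(* Rotations are products of shears, so Lebesgue measure on the plane and P are
   rotation invariant. Hence the distortion of a regular n-gon with circumradius
   r centred at the origin, with or without the origin added, is n times its
   contribution from the Voronoi cell |y| cos(pi/n) <= x sin(pi/n) of one vertex,
   which Fubini's theorem evaluates:
     hexagon:           1/2 + r^2 - (4/pi) r >= 1/2 - 4/pi^2 > 0.094,
     origin + pentagon: f r = 1/2 + r^2 - L r - Q r^4 for r <= 8/5,
   with L = 20 sin(pi/5) / (3 pi) and Q = 5 tan(pi/5) / (12 pi), while for
   r >= 8/5 the latter distortion is at least 0.18. If u is the root of
   f' r = 2 r - L - 4 Q r^3 near 0.6858, then
     f r - f u = (r - u)^2 (1 - Q (r^2 + 2 r u + 3 u^2)),
   so u is the only minimiser, c = u^2 and V_6 = f u. An optimal set exists by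
   compactness, because clamping points to the square [-1, 1]^2 does not increase
   the distortion. All rotations of the optimal pentagon are then optimal, and
   their vertices fill a circle, which is uncountable. *)

Require Import Defs.
From HB Require Import structures.
From mathcomp Require Import all_boot all_order all_algebra.
From mathcomp Require Import all_classical all_reals all_analysis.
From mathcomp Require Import measurable_realfun ring lra.
Import Order.TTheory GRing.Theory Num.Theory.
Import numFieldNormedType.Exports.
Local Open Scope classical_set_scope.
Local Open Scope ring_scope.

Set Implicit Arguments.
Unset Strict Implicit.

(** * Rotation invariance *)

Section lebesgue_plane.
Context {R : realType}.
Notation leb := (@lebesgue_measure R).
Implicit Types (A : set (plane R)) (a k t : R).

Definition plane_measure : set (plane R) -> \bar R := (leb \x leb)%E.

Lemma measurable_addl t :
  measurable_fun setT (fun x : measurableTypeR R => t + x : measurableTypeR R).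
Proof. by apply: measurable_funD. Qed.

(** The pushforward of Lebesgue measure under a translation gives each half-open interval its
    length, and such a measure is unique. *)
Lemma lebesgue_measure_translate t (A : set (measurableTypeR R)) :
  measurable A -> leb ((fun x => t + x) @^-1` A) = leb A.
Proof.
move=> mA; have mt := measurable_addl t.
apply/esym; rewrite [RHS](_ : _ =
  pushforward leb ((fun x => t + x) : measurableTypeR R -> measurableTypeR R) A)//.
apply: lebesgue_measure_unique => //.
move=> _ [[a b]] _ <-; rewrite /= /pushforward.
have -> : (fun x => t + x) @^-1` `]a, b] = `]a - t, b - t]%classic :> set R.
  by apply/seteqP; split => x/=; rewrite !in_itv/=; lra.
rewrite !lebesgue_measure_itv/= !lte_fin ltrD2r; case: ifP => // _.
by rewrite -!EFinB; congr (_%:E); lra.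
Qed.

Definition hshear k (x : R * R) : R * R := (x.1 + k * x.2, x.2).
Definition vshear k (x : R * R) : R * R := (x.1, x.2 + k * x.1).

Lemma measurable_hshear k : measurable_fun setT (hshear k : plane R -> plane R).
Proof.
apply/measurable_fun_pair => //=.
by apply: measurable_funD => //; apply: measurable_funM.
Qed.

Lemma measurable_vshear k : measurable_fun setT (vshear k : plane R -> plane R).
Proof.
apply/measurable_fun_pair => //=.
by apply: measurable_funD => //; apply: measurable_funM.
Qed.

(** Each vertical section of the preimage is a translate of the corresponding section of [A], so the
    integrands defining the product measure agree pointwise. *)
Lemma plane_measure_vshear k A : measurable A ->
  plane_measure (vshear k @^-1` A) = plane_measure A.
Proof.
move=> mA; apply: eq_integral => x _ /=.
rewrite -[RHS](lebesgue_measure_translate (k * x))//; last exact: measurable_xsection.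
by congr (leb _); apply/seteqP; split => y; rewrite /xsection/= !inE/= addrC.
Qed.

(** The product measure is built from vertical sections. A horizontal shear translates horizontal
    sections, so the other order of integration is needed; both orders agree on rectangles, hence
    everywhere. *)
Lemma plane_measureE A : measurable A ->
  plane_measure A = (\int[leb]_y leb (ysection A y))%E.
Proof.
move=> mA.
have -> : (\int[leb]_y leb (ysection A y) = (leb \x^ leb) A)%E by [].
apply: product_measure_unique => // X Y mX mY.
exact: product_measure2E.
Qed.

Lemma plane_measure_hshear k A : measurable A ->
  plane_measure (hshear k @^-1` A) = plane_measure A.
Proof.
move=> mA; rewrite !plane_measureE//; last first.
  by rewrite -[X in measurable X]setTI; exact: measurable_hshear.
apply: eq_integral => x _ /=.
rewrite -[RHS](lebesgue_measure_translate (k * x))//; last exact: measurable_ysection.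
by congr (leb _); apply/seteqP; split => y; rewrite /ysection/= !inE/= addrC.
Qed.

Definition rotation a (x : R * R) : R * R :=
  (x.1 * cos a - x.2 * sin a, x.1 * sin a + x.2 * cos a).

Lemma measurable_rot a : measurable_fun setT (rotation a : plane R -> plane R).
Proof.
apply/measurable_fun_pair => //=.
  by apply: measurable_funB; apply: measurable_funM.
by apply: measurable_funD; apply: measurable_funM.
Qed.

Lemma rotationD a b x : rotation (a + b) x = rotation a (rotation b x).
Proof. by rewrite /rotation/= cosD sinD; congr pair; ring. Qed.

Lemma rotation0 x : rotation 0 x = x.
Proof. by case: x => x y; rewrite /rotation/= cos0 sin0; congr pair; ring. Qed.

(** The three-shear factorisation of a rotation. The angle is written [h + h] because the shear
    coefficient is the tangent of the half angle, which excludes the half turn. *)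
Lemma rot_half_shear h : cos h != 0 ->
  rotation (h + h) = hshear (- tan h) \o vshear (sin (h + h)) \o hshear (- tan h).
Proof.
move=> c0; apply/funext => -[x y]; rewrite /rotation /hshear /vshear/= /tan.
have e : sin h ^+ 2 = 1 - cos h ^+ 2 by rewrite -(cos2Dsin2 h); ring.
rewrite cosD sinD; congr pair.
- rewrite (_ : sin h * sin h = 1 - cos h ^+ 2); last by rewrite -e expr2.
  transitivity (x * (1 - 2 * sin h ^+ 2) - y * (2 * sin h * (1 - sin h ^+ 2) / cos h)).
    by rewrite !e; field.
  by field.
- rewrite (_ : sin h * sin h = 1 - cos h ^+ 2); last by rewrite -e expr2.
  transitivity (x * (sin h * cos h + cos h * sin h) + y * (1 - 2 * sin h ^+ 2)).
    by rewrite !e; field.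
  by field.
Qed.

Lemma plane_measure_rot a A : measurable A ->
  plane_measure (rotation a @^-1` A) = plane_measure A.
Proof.
have half h B : cos h != 0 -> measurable B ->
    plane_measure (rotation (h + h) @^-1` B) = plane_measure B.
  move=> c0 mB; rewrite rot_half_shear// !comp_preimage.
  have m1 : measurable (hshear (- tan h) @^-1` B).
    by rewrite -[X in measurable X]setTI; exact: measurable_hshear.
  have m2 : measurable (vshear (sin (h + h)) @^-1` (hshear (- tan h) @^-1` B)).
    by rewrite -[X in measurable X]setTI; exact: measurable_vshear.
  by rewrite plane_measure_hshear// plane_measure_vshear// plane_measure_hshear.
move=> mA; have -> : a = a / 2 + a / 2 by field.
(* When [cos (a / 2)] vanishes, the rotation is performed as two rotations by [a / 2]. Their half
   angle [a / 4] is admissible, since otherwise its sine and cosine would both be zero. *)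
have [c0|] := eqVneq (cos (a / 2)) 0; last by move=> /half ->.
have -> : rotation (a / 2 + a / 2) = rotation (a / 2) \o rotation (a / 2).
  by apply/funext => x; rewrite /= rotationD.
have q0 : cos (a / 4) != 0.
  apply/eqP => q; move: c0; have -> : a / 2 = a / 4 + a / 4 by field.
  rewrite cosD q mul0r sub0r => /eqP; rewrite oppr_eq0 mulf_eq0 orbb => /eqP s.
  by have := cos2Dsin2 (a / 4); rewrite q s !expr0n/= addr0 => /eqP; rewrite eq_sym oner_eq0.
have -> : a / 2 = a / 4 + a / 4 by field.
rewrite comp_preimage half// ?half//.
by rewrite -[X in measurable X]setTI; exact: measurable_rot.
Qed.

Lemma measurable_line (w : R * R) :
  measurable ([set x | x.1 * w.1 + x.2 * w.2 = 0] : set (plane R)).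
Proof.
have mf : measurable_fun setT (fun x : plane R => x.1 * w.1 + x.2 * w.2).
  by apply: measurable_funD; apply: measurable_funM.
rewrite -[X in measurable X]setTI.
exact: (mf measurableT [set 0] (measurable_set1 0)).
Qed.

(** Sections taken along a coordinate with nonzero coefficient are single points, hence null. *)
Lemma plane_measure_line (w : R * R) : w != (0, 0) ->
  plane_measure [set x | x.1 * w.1 + x.2 * w.2 = 0] = 0%E.
Proof.
case: w => u v uv /=.
have mL := measurable_line (u, v).
have [u0|u0] := eqVneq u 0.
  have v0 : v != 0 by apply: contra uv => /eqP ->; rewrite u0.
  rewrite /plane_measure /product_measure1 integral0_eq// => x _ /=.
  have -> : xsection [set x0 | x0.1 * u + x0.2 * v = 0] x = [set 0].
    apply/seteqP; split => y; rewrite /xsection/= !inE/= u0.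
      by rewrite mulr0 add0r => /eqP; rewrite mulf_eq0 (negbTE v0) orbF => /eqP.
    by move=> ->; ring.
  exact: lebesgue_measure_set1.
rewrite plane_measureE// integral0_eq// => y _ /=.
have -> : ysection [set x0 | x0.1 * u + x0.2 * v = 0] y = [set - (y * v) / u].
  apply/seteqP; split => x; rewrite /ysection/= !inE/=.
    by move=> /eqP; rewrite addr_eq0 => /eqP <-; field.
  by move=> ->; field.
exact: lebesgue_measure_set1.
Qed.

End lebesgue_plane.

(** * The uniform distribution as scaled Lebesgue measure on the disc *)

Section uniform_disc.
Context {R : realType} (P : probability (plane R) R).
Hypothesis P_uniform : is_uniform_disc P.
Notation leb := (@lebesgue_measure R).
Local Notation D := (@unit_disc R).
Implicit Types (A S : set (plane R)) (f : plane R -> R).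

Lemma measurable_sq_norm :
  measurable_fun setT (fun x : plane R => x.1 ^+ 2 + x.2 ^+ 2).
Proof. by apply: measurable_funD; apply: measurable_funX. Qed.

Lemma measurable_unit_disc : measurable (D : set (plane R)).
Proof.
rewrite -[X in measurable X]setTI (_ : D = (fun x : plane R => x.1 ^+ 2 + x.2 ^+ 2) @^-1` `]-oo, 1]).
  by apply: measurable_sq_norm.
by apply/seteqP; split => x; rewrite /unit_disc/= in_itv.
Qed.

Lemma uniform_discE A : measurable A ->
  P A = (pi^-1%:E * plane_measure (A `&` D))%E.
Proof.
move=> mA; rewrite P_uniform//.
have mD := measurable_unit_disc.
under eq_integral do rewrite EFinM.
have p0 : 0 <= pi^-1 :> R by rewrite invr_ge0 pi_ge0.
rewrite ge0_integralZl//=.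
- by congr (_ * _)%E; rewrite integral_indic// setIC.
- apply/measurable_EFinP; apply: measurable_funTS; exact: measurable_indic.
Qed.

Lemma uniform_disc_setC : P (~` (D : set (plane R))) = 0%E.
Proof.
have mD := measurable_unit_disc.
rewrite uniform_discE; last exact: measurableC.
by rewrite setICl /plane_measure measure0 mule0.
Qed.

Lemma integral_setI_disc S (g : plane R -> \bar R) : measurable S ->
  measurable_fun setT g -> (forall x, 0 <= g x)%E ->
  (\int[P]_(x in S) g x = \int[P]_(x in S `&` D) g x)%E.
Proof.
move=> mS mg g0; have mD := measurable_unit_disc.
rewrite (@ge0_negligible_integral _ _ _ P S (~` D))//.
- by rewrite setDE setCK.
- exact: measurableC.
- exact: measurable_funTS.
- exact: uniform_disc_setC.
Qed.

(** The complement of the disc is [P]-null, and on measurable subsets of the disc [P] is Lebesgue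
    measure scaled by [pi^-1]. *)
Lemma uniform_disc_integral S (g : plane R -> \bar R) : measurable S ->
  measurable_fun setT g -> (forall x, 0 <= g x)%E ->
  (\int[P]_(x in S) g x =
   pi^-1%:E * \int[(leb \x leb)%E]_(x in S `&` D) g x)%E.
Proof.
move=> mS mg g0; have mD := measurable_unit_disc.
have p0 : 0 <= pi^-1 :> R by rewrite invr_ge0 pi_ge0.
pose k := NngNum p0.
rewrite integral_setI_disc//.
rewrite (@eq_measure_integral _ _ _ _ (mscale k (leb \x leb)%E)); last first.
  move=> A mA AS; rewrite [LHS]uniform_discE//; congr (_ * _)%E.
  by congr plane_measure; apply/setIidl => x /AS[].
rewrite ge0_integral_mscale//; first exact: measurableI.
exact: measurable_funTS.
Qed.

Lemma unit_disc_rot a : rotation a @^-1` (D : set (plane R)) = D.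
Proof.
apply/seteqP; split => x; rewrite /unit_disc/= /rotation/=;
  have := cos2Dsin2 a; set c := cos a; set s := sin a => cs.
all: suff -> : (x.1 * c - x.2 * s) ^+ 2 + (x.1 * s + x.2 * c) ^+ 2
  = (x.1 ^+ 2 + x.2 ^+ 2) * (c ^+ 2 + s ^+ 2) by rewrite cs mulr1.
all: ring.
Qed.

Lemma uniform_disc_rot a A : measurable A -> P (rotation a @^-1` A) = P A.
Proof.
move=> mA; rewrite !uniform_discE//; last first.
  by rewrite -[X in measurable X]setTI; exact: measurable_rot.
have mD := measurable_unit_disc.
congr (_ * _)%E; rewrite -[RHS](plane_measure_rot a); last exact: measurableI.
by rewrite preimage_setI unit_disc_rot.
Qed.

Lemma uniform_disc_line (w : R * R) : w != (0, 0) ->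
  P ([set x | x.1 * w.1 + x.2 * w.2 = 0] : set (plane R)) = 0%E.
Proof.
move=> w0; have mD := measurable_unit_disc.
have mL := measurable_line w.
rewrite uniform_discE// [X in (_ * X)%E](_ : _ = 0%E) ?mule0//.
apply/eqP; rewrite /plane_measure eq_le measure_ge0 andbT -[leRHS](plane_measure_line w0).
by apply: le_measure; rewrite ?inE//; exact: measurableI.
Qed.

(** Change of variables: [P] is its own pushforward under a rotation. *)
Lemma integral_rot a S (g : plane R -> \bar R) : measurable S ->
  measurable_fun setT g -> (forall x, 0 <= g x)%E ->
  (\int[P]_(x in S) g x = \int[P]_(x in rotation a @^-1` S) g (rotation a x))%E.
Proof.
move=> mS mg g0; have mr := measurable_rot a.
transitivity (\int[pushforward P (rotation a : plane R -> plane R)]_(x in S) g x)%E.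
  by apply: eq_measure_integral => A mA _; exact/esym/uniform_disc_rot.
by rewrite ge0_integral_pushforward//; exact: measurable_funTS.
Qed.

End uniform_disc.

(** * Voronoi cells of a regular polygon *)

Section sector.
Context {R : realType}.
Implicit Types (x : R * R) (a b : R) (k m n : nat).

(** Among points at a common positive distance from the origin, the one nearest to [x] is the one
    whose direction [b] maximises this projection. *)
Definition dirproj b x : R := x.1 * cos b + x.2 * sin b.

Lemma dirproj_rotation a b x : dirproj b (rotation a x) = dirproj (b - a) x.
Proof. by rewrite /dirproj /rotation/= cosB sinB; ring. Qed.

Lemma dirproj0 x : dirproj 0 x = x.1.
Proof. by rewrite /dirproj cos0 sin0; ring. Qed.

(** Doubling the angle lets the difference factor; the last factor vanishes on the line at angle
    [b], the bisector of the directions [0] and [b + b]. *)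
Lemma fst_sub_proj b x :
  x.1 - dirproj (b + b) x = 2 * sin b * (x.1 * sin b - x.2 * cos b).
Proof.
rewrite /dirproj cosD sinD.
have -> : sin b * sin b = 1 - cos b ^+ 2 by rewrite -(cos2Dsin2 b); ring.
transitivity (x.1 * (2 * (1 - cos b ^+ 2)) - 2 * sin b * x.2 * cos b); first by ring.
have -> : 1 - cos b ^+ 2 = sin b ^+ 2 by rewrite -(cos2Dsin2 b); ring.
by ring.
Qed.

Definition vertex_angle n k : R := 2 * pi * k%:R / n%:R.

(* The Voronoi cell of the first vertex among the vertices of a regular n-gon. *)
Definition sector n : set (R * R) :=
  [set x | `|x.2| * cos (pi / n%:R) <= x.1 * sin (pi / n%:R)].

Lemma measurable_sector n : measurable (sector n : set (plane R)).
Proof.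
have mf : measurable_fun setT
    (fun x : plane R => x.1 * sin (pi / n%:R) - `|x.2| * cos (pi / n%:R)).
  apply: measurable_funB; apply: measurable_funM => //.
  exact: measurableT_comp.
rewrite -[X in measurable X]setTI (_ : sector n = (fun x : plane R =>
    x.1 * sin (pi / n%:R) - `|x.2| * cos (pi / n%:R)) @^-1` `[0, +oo[).
  exact: mf.
by apply/seteqP; split => x; rewrite /sector/= in_itv/= andbT subr_ge0.
Qed.

Lemma pi_div_gt0 n : (0 < n)%N -> 0 < pi / n%:R :> R.
Proof. by move=> n0; rewrite divr_gt0 ?pi_gt0// ltr0n. Qed.

Lemma pi_div_le n m : (0 < m)%N -> (m <= n)%N -> pi / n%:R <= pi / m%:R :> R.
Proof.
move=> m0 mn; rewrite ler_pM2l ?pi_gt0// lef_pV2 ?posrE ?ltr0n// ?ler_nat//.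
exact: leq_trans mn.
Qed.

Lemma sin_pi_div_gt0 n : (1 < n)%N -> 0 < sin (pi / n%:R) :> R.
Proof.
move=> n1; rewrite sin_gt0_pi// pi_div_gt0 ?(ltnW n1)//=.
rewrite (le_lt_trans (pi_div_le (m := 2) _ n1))//.
by rewrite ltr_pdivrMr// ltr_pMr ?pi_gt0// ltr1n.
Qed.

Lemma cos_pi_div_ge0 n : (1 < n)%N -> 0 <= cos (pi / n%:R) :> R.
Proof.
move=> n1; apply: cos_ge0_pihalf; rewrite (pi_div_le (m := 2) _ n1)// andbT.
by rewrite (@le_trans _ _ 0)// ?oppr_le0 ?divr_ge0 ?pi_ge0// ltW// pi_div_gt0 ?ltnW.
Qed.

Lemma sector_fst_ge0 n x : (1 < n)%N -> sector n x -> 0 <= x.1.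
Proof.
move=> n1 xS; rewrite -(pmulr_lge0 _ (sin_pi_div_gt0 n1)).
by apply: le_trans xS; rewrite mulr_ge0// cos_pi_div_ge0.
Qed.

(** The angle lies between [pi / n] and [pi - pi / n], and cosine decreases on [[0, pi]]. *)
Lemma norm_cos_multiple_le n k : (0 < k < n)%N ->
  `|cos (pi * k%:R / n%:R)| <= cos (pi / n%:R) :> R.
Proof.
move=> /andP[k0 kn]; have n0 : (0 < n)%N by rewrite (leq_trans _ kn).
have nr : 0 < n%:R :> R by rewrite ltr0n.
have pn := pi_div_gt0 n0.
have E : pi * k%:R / n%:R = k%:R * (pi / n%:R) :> R by ring.
have E2 : pi = n%:R * (pi / n%:R) :> R by field; rewrite gt_eqF.
have k1 : 1 <= k%:R :> R by rewrite ler1n.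
have kn1 : k%:R + 1 <= n%:R :> R by rewrite natr1 ler_nat.
have cc t u : 0 <= t -> t <= u -> u <= pi -> cos u <= cos t :> R.
  move=> t0; rewrite le_eqVlt => /orP[/eqP -> //|tu] up.
  by rewrite ltW// ltr_cos// in_itv/= ?t0 ?up ?(le_trans (ltW tu)) ?(le_trans t0 (ltW tu)).
rewrite ler_norml; apply/andP; split.
  have -> : - cos (pi / n%:R) = cos (pi - pi / n%:R) :> R by rewrite cosB cospi sinpi; ring.
  apply: cc; rewrite ?E.
  - by rewrite mulr_ge0// ltW.
  - by rewrite -subr_ge0 {1}E2; nra.
  - by rewrite gerBl ltW.
by apply: cc; rewrite ?E; [exact: ltW|nra|rewrite [leRHS]E2; nra].
Qed.

Lemma sin_multiple_ge n k : (0 < k < n)%N ->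
  sin (pi / n%:R) <= sin (pi * k%:R / n%:R) :> R.
Proof.
move=> kn; have n1 : (1 < n)%N by case/andP: kn => k0; apply: leq_ltn_trans.
have cl := norm_cos_multiple_le kn; have s0 := sin_pi_div_gt0 n1.
have s1 : 0 <= sin (pi * k%:R / n%:R) :> R.
  case/andP: kn => k0 kn; rewrite sin_ge0_pi// divr_ge0 ?mulr_ge0 ?pi_ge0//=.
  by rewrite ler_pdivrMr ?ltr0n ?(ltn_trans k0)// ler_pM2l ?pi_gt0// ler_nat ltnW.
rewrite -(ler_pXn2r (n := 2)) ?nnegrE ?(ltW s0)//.
have e t : sin t ^+ 2 = 1 - cos t ^+ 2 :> R by rewrite -(cos2Dsin2 t); ring.
rewrite !e lerD2l lerN2 -real_normK ?num_real//.
by rewrite ler_pXn2r// nnegrE cos_pi_div_ge0.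
Qed.

(** In the factorisation at [b = pi * k / n] the bracket is nonnegative: compared with [pi / n], the
    cosine does not grow in absolute value and the sine does not shrink, so the inequality of the
    sector persists at [b]. *)
Lemma sector_proj_le n k x : (0 < k < n)%N -> sector n x ->
  dirproj (vertex_angle n k) x <= x.1 /\ dirproj (- vertex_angle n k) x <= x.1.
Proof.
move=> kn xS; have n1 : (1 < n)%N by case/andP: kn => k0; apply: leq_ltn_trans.
have x0 := sector_fst_ge0 n1 xS.
have s := sin_multiple_ge kn; have c := norm_cos_multiple_le kn.
have s0 := sin_pi_div_gt0 n1.
set b := pi * k%:R / n%:R in s c.
have sb : 0 < sin b by rewrite (lt_le_trans s0).
have key : `|x.2 * cos b| <= x.1 * sin b.
  rewrite normrM (le_trans (ler_wpM2l _ c))// (le_trans xS)//.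
  exact: ler_wpM2l.
have E : vertex_angle n k = b + b by rewrite /vertex_angle /b; ring.
move: key; rewrite ler_norml => /andP[k1 k2].
rewrite E; split; rewrite -subr_ge0.
  by rewrite fst_sub_proj !mulr_ge0 ?(ltW sb)//; lra.
rewrite (opprD b b) fst_sub_proj sinN cosN.
have -> : 2 * - sin b * (x.1 * - sin b - x.2 * cos b) =
  2 * sin b * (x.1 * sin b + x.2 * cos b) by ring.
by rewrite !mulr_ge0 ?(ltW sb)//; lra.
Qed.

Lemma sector_proj_sub_le n j k x : (j < n)%N -> (k < n)%N -> sector n x ->
  dirproj (vertex_angle n j - vertex_angle n k) x <= x.1.
Proof.
move=> jn kn xS.
have E m l : (l <= m)%N -> vertex_angle n m - vertex_angle n l = vertex_angle n (m - l).
  by move=> lm; rewrite /vertex_angle natrB//; ring.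
have [jk|kj|<-] := ltngtP j k; last by rewrite subrr dirproj0.
- rewrite -opprB E ?(ltnW jk)//; apply: (sector_proj_le _ xS).2.
  by rewrite subn_gt0 jk/= (leq_ltn_trans (leq_subr _ _)).
- rewrite E ?(ltnW kj)//; apply: (sector_proj_le _ xS).1.
  by rewrite subn_gt0 kj/= (leq_ltn_trans (leq_subr _ _)).
Qed.

(** The Voronoi cell of vertex [k], written as a preimage so that [integral_rot] carries integrals
    over it to [sector n]. *)
Definition cell n k : set (R * R) := rotation (- vertex_angle n k) @^-1` sector n.

Lemma measurable_cell n k : measurable (cell n k : set (plane R)).
Proof.
rewrite -[X in measurable X]setTI; apply: measurable_rot => //.
exact: measurable_sector.
Qed.

Lemma cell_proj_le n j k x : (j < n)%N -> (k < n)%N -> cell n k x ->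
  dirproj (vertex_angle n j) x <= dirproj (vertex_angle n k) x.
Proof.
move=> jn kn /(sector_proj_sub_le jn kn).
by rewrite -dirproj0 !dirproj_rotation sub0r !opprK subrK.
Qed.

(** Choose the vertex direction with the largest projection of [x]. Comparison with its two
    neighbours alone gives the two half-plane conditions of the sector. *)
Lemma cell_cover n x : (1 < n)%N -> exists2 k, (k < n)%N & cell n k x.
Proof.
move=> n1; have n0 := ltnW n1; have nr : n%:R != 0 :> R by rewrite pnatr_eq0 -lt0n.
pose i0 := Ordinal n0.
pose p (i : 'I_n) := dirproj (vertex_angle n i) x.
case: (@arg_maxP _ _ _ i0 xpredT p) => // i _ imax.
exists i => //; rewrite /cell/=; set y := rotation _ x.
have p2 t : dirproj (t + (pi + pi)) x = dirproj t x.
  by rewrite /dirproj -[pi + pi]mulr2n cosD2pi sinD2pi.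
have hy b : dirproj b y = dirproj (b + vertex_angle n i) x by rewrite dirproj_rotation opprK.
have y1 : y.1 = p i by rewrite -dirproj0 hy add0r.
have hp : dirproj (pi / n%:R + pi / n%:R) y <= y.1.
  rewrite y1 hy.
  have [l|g] := ltnP i.+1 n.
    apply: le_trans (imax (Ordinal l) isT); rewrite le_eqVlt; apply/orP; left.
    apply/eqP; congr dirproj; rewrite /vertex_angle/= -natr1; ring.
  (* After the last vertex comes vertex [0], whose angle differs by a full turn. *)
  have e : i.+1 = n by apply/eqP; rewrite eqn_leq g ltn_ord.
  apply: le_trans (imax i0 isT); rewrite le_eqVlt; apply/orP; left.
  apply/eqP; rewrite /p -[RHS]p2; congr dirproj.
  rewrite /vertex_angle/= mulr0 mul0r add0r.
  have e2 : i%:R + 1 = n%:R :> R by rewrite natr1 e.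
  transitivity (2 * pi * (i%:R + 1) / n%:R : R); first by field.
  by rewrite e2; field.
have hm : dirproj (- (pi / n%:R) + - (pi / n%:R)) y <= y.1.
  rewrite y1 hy.
  (* Before vertex [0] comes vertex [n.-1], again up to a full turn. *)
  case: (posnP i) => [e|ip].
    have l : (n.-1 < n)%N by rewrite prednK.
    apply: le_trans (imax (Ordinal l) isT); rewrite le_eqVlt; apply/orP; left.
    apply/eqP; rewrite -[LHS]p2 /p; congr dirproj; rewrite /vertex_angle/= e -subn1 natrB//.
    by field.
  have l : (i.-1 < n)%N by rewrite prednK// ltnW.
  apply: le_trans (imax (Ordinal l) isT); rewrite le_eqVlt; apply/orP; left.
  by apply/eqP; congr dirproj; rewrite /vertex_angle/= -subn1 natrB//; field.
have s0 := sin_pi_div_gt0 n1; have c0 := cos_pi_div_ge0 n1.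
have pr b : dirproj (b + b) y <= y.1 -> 0 <= 2 * sin b * (y.1 * sin b - y.2 * cos b).
  by rewrite -fst_sub_proj subr_ge0.
move: (pr _ hp) (pr _ hm); rewrite /sector /mkset.
move: y {hy y1 hp hm pr} => y; rewrite sinN cosN.
set s := sin (pi / n%:R) in s0 *; set c := cos (pi / n%:R) in c0 *.
have -> : 2 * - s * (y.1 * - s - y.2 * c) = 2 * s * (y.1 * s + y.2 * c) by ring.
rewrite !pmulr_rge0 ?mulr_gt0// => hp hm.
by rewrite -[X in `|_| * X]ger0_norm// -normrM ler_norml; apply/andP; split; lra.
Qed.

Lemma cell_inter n j k x : (j < k < n)%N -> cell n j x -> cell n k x ->
  x.1 * (cos (vertex_angle n j) - cos (vertex_angle n k)) +
  x.2 * (sin (vertex_angle n j) - sin (vertex_angle n k)) = 0.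
Proof.
move=> /andP[jk kn] xj xk; have jn := ltn_trans jk kn.
have := cell_proj_le jn kn xk; have := cell_proj_le kn jn xj.
by rewrite /dirproj => h1 h2; lra.
Qed.

(** Equal vertices would give [cos (b + b) = 1] for [b = pi * (k - j) / n], although [sin b] is
    positive. Hence the bisector in [cell_inter] is a genuine line and therefore null. *)
Lemma vertex_neq n j k : (j < k < n)%N ->
  (cos (vertex_angle n j) - cos (vertex_angle n k),
   sin (vertex_angle n j) - sin (vertex_angle n k)) != (0, 0).
Proof.
move=> /andP[jk kn]; apply/eqP => -[/eqP]; rewrite subr_eq0 => /eqP c /eqP.
rewrite subr_eq0 => /eqP s.
have kj : (0 < k - j < n)%N by rewrite subn_gt0 jk (leq_ltn_trans (leq_subr _ _)).
have n1 : (1 < n)%N by case/andP: kj => ?; apply: leq_ltn_trans.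
have := sin_multiple_ge kj; set b := pi * _ / _ => sb.
have {}sb : 0 < sin b by rewrite (lt_le_trans _ sb)// sin_pi_div_gt0.
have : cos (b + b) = 1.
  have -> : b + b = vertex_angle n k - vertex_angle n j.
    by rewrite /b /vertex_angle natrB ?(ltnW jk)//; ring.
  by rewrite cosB c s -(cos2Dsin2 (vertex_angle n k)); ring.
rewrite cosD -(cos2Dsin2 b) => e; nra.
Qed.

End sector.

(** * Reduction of symmetric integrals to one cell *)

Section sector_integral.
Context {R : realType} (P : probability (plane R) R).
Hypothesis P_uniform : is_uniform_disc P.

Lemma ae_cells_disjoint n :
  {ae P, forall x, forall j k, (j < k < n)%N -> ~ (cell n j x /\ cell n k x)}.
Proof.
apply: ae_foralln => j; apply: ae_foralln => k.
have [jkn|njkn] := boolP (j < k < n)%N; last exact: aeW.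
have w0 := vertex_neq (R := R) jkn.
exists [set x | x.1 * (cos (vertex_angle n j) - cos (vertex_angle n k)) +
  x.2 * (sin (vertex_angle n j) - sin (vertex_angle n k)) = 0]; split.
- exact: (measurable_line (_, _)).
- exact: (uniform_disc_line P_uniform w0).
- move=> x /= h; apply: contrapT => h2; apply: h => _ [cj ck]; apply: h2.
  exact: cell_inter jkn cj ck.
Qed.

(** The cells cover the plane, overlap in a null set, and are carried to the sector by rotations
    preserving both [P] and [g]. *)
Lemma integral_sector n (g : plane R -> \bar R) : (1 < n)%N ->
  measurable_fun setT g -> (forall x, 0 <= g x)%E ->
  (forall x, g (rotation (2 * pi / n%:R) x) = g x) ->
  (\int[P]_x g x = n%:R%:E * \int[P]_(x in sector n) g x)%E.
Proof.
move=> n1 mg g0 gr.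
have gk k x : g (rotation (vertex_angle n k) x) = g x.
  elim: k => [|k <-]; first by rewrite /vertex_angle mulr0 mul0r rotation0.
  rewrite -[RHS]gr -rotationD; congr (g (rotation _ x)).
  by rewrite /vertex_angle -natr1; ring.
have gN k x : g (rotation (- vertex_angle n k) x) = g x.
  by rewrite -(gk k) -rotationD subrr rotation0.
(* Almost every point lies in exactly one cell, so exactly one summand survives there. *)
transitivity (\int[P]_x \sum_(k < n) (g \_ (cell n k)) x)%E.
  apply: ge0_ae_eq_integral => //.
  - apply: emeasurable_sum => k; apply/(measurable_restrictT g (measurable_cell n k)).
    exact: measurable_funTS.
  - by move=> x _; apply: sume_ge0 => k _; apply: erestrict_ge0.
  - have := ae_cells_disjoint n.
    apply: (@filterS _ _ (ae_filter_ringOfSetsType P)) => x dis _.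
    have [k kn xk] := cell_cover x n1.
    rewrite (bigD1 (Ordinal kn))//= big1 ?adde0.
      by rewrite patchE mem_set.
    move=> j jk; rewrite patchE memNset// => xj.
    have [l|l|e] := ltngtP j k.
    + by apply: (dis j k); rewrite ?l.
    + by apply: (dis k j); rewrite ?l/=.
    + by move: jk; rewrite -val_eqE/= e eqxx.
rewrite ge0_integral_sum//; first last.
- by move=> k x _; apply: erestrict_ge0.
- move=> k; apply/(measurable_restrictT g (measurable_cell n k)).
  exact: measurable_funTS.
transitivity (\sum_(k < n) \int[P]_(x in sector n) g x)%E.
  apply: eq_bigr => k _; rewrite -integral_mkcond.
  rewrite [RHS](integral_rot P_uniform (- vertex_angle n k))//.
  - by apply: eq_integral => x _; rewrite gN.
  - exact: measurable_sector.
by rewrite mule_natl sumr_const card_ord.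
Qed.

End sector_integral.

(** * Integrals over a sector of the disc *)

Section antiderivative.
Context {R : realType}.
Notation leb := (@lebesgue_measure R).

(** The case [a = b] is included because degenerate slices occur, for instance at the corners of the
    sector on the unit circle. *)
Lemma integral_antiderivative (f F : R -> R) (a b : R) : a <= b ->
  continuous f -> (forall x : R, is_derive x 1 F (f x)) ->
  (\int[leb]_(x in `[a, b]) (f x)%:E = (F b - F a)%:E)%E.
Proof.
move=> ab cf dF; move: ab; rewrite le_eqVlt => /orP[/eqP ->|ab].
  by rewrite set_itv1 integral_set1 subrr.
have cF : continuous F.
  by move=> x; apply/differentiable_continuous/derivable1_diffP/(@ex_derive _ _ _ _ _ _ _ (dF x)).
rewrite (@continuous_FTC2 _ f F)//.
- exact: continuous_subspaceT.
- split => [x _||]; first exact: (@ex_derive _ _ _ _ _ _ _ (dF x)).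
  + exact/cvg_at_right_filter/cF.
  + exact/cvg_at_left_filter/cF.
- by move=> x _; rewrite derive1E; apply: derive_val.
Qed.

Lemma integral_id_itv (a b : R) : a <= b ->
  (\int[leb]_(x in `[a, b]) x%:E = ((b ^+ 2 - a ^+ 2) / 2)%:E :> \bar R)%E.
Proof.
move=> ab; rewrite (_ : (_ - _) / 2 = b ^+ 2 / 2 - a ^+ 2 / 2); last by field.
apply: (@integral_antiderivative id (fun x => x ^+ 2 / 2)) => // x; first exact: cvg_id.
by apply: is_derive_eq; rewrite /GRing.scale/=; field.
Qed.

End antiderivative.

Section disc_integrals.
Context {R : realType} (P : probability (plane R) R).
Hypothesis P_uniform : is_uniform_disc P.
Notation leb := (@lebesgue_measure R).
Local Notation D := (@unit_disc R).

(** The slice at height [y] runs from [|y| c / s] to [sqrt (1 - y^2)] and is nonempty only for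
    [|y| <= s]. The absolute value changes nothing on the sector and makes the integrand nonnegative
    everywhere, as Tonelli requires. *)
Lemma integral_sector_fst n : (1 < n)%N ->
  (\int[P]_(x in sector n) `|x.1|%:E = (2 * sin (pi / n%:R) / (3 * pi))%:E)%E.
Proof.
move=> n1; set s := sin _; set c := cos (pi / n%:R : R).
have s0 : 0 < s by exact: sin_pi_div_gt0.
have c0 : 0 <= c by exact: cos_pi_div_ge0.
have cs : c ^+ 2 + s ^+ 2 = 1 by exact: cos2Dsin2.
have mS := measurable_sector (R := R) n.
have mSD : measurable (sector n `&` D : set (plane R)).
  by apply: measurableI => //; exact: measurable_unit_disc.
have mf : measurable_fun setT (fun x : plane R => `|x.1|%:E).
  by apply/measurable_EFinP; exact: measurableT_comp.
rewrite (uniform_disc_integral P_uniform)//.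
rewrite integral_mkcond fubini_tonelli2//=; last 2 first.
- by apply/(measurable_restrictT _ mSD); exact: measurable_funTS.
- by move=> x; apply: erestrict_ge0.
transitivity ((pi^-1)%:E * \int[leb]_(y in `[(- s)%R, s]) ((1 - y ^+ 2 / s ^+ 2) / 2)%R%:E)%E.
  congr (_ * _)%E; rewrite [RHS]integral_mkcond; apply: eq_integral => y _.
  rewrite /fubini_G patchE; case: ifPn => [|].
    rewrite inE/= in_itv/= => /andP[y1 y2].
    have y21 : y ^+ 2 <= s ^+ 2 by nra.
    have q0 : 0 <= 1 - y ^+ 2 by nra.
    rewrite (_ : (1 - _) / 2 = (Num.sqrt (1 - y ^+ 2) ^+ 2 - (`|y| * c / s) ^+ 2) / 2); last first.
      rewrite sqr_sqrtr// !exprMn real_normK ?num_real//.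
      have -> : c ^+ 2 = 1 - s ^+ 2 by rewrite -cs; ring.
      by field; rewrite gt_eqF.
    rewrite -integral_id_itv; last first.
      rewrite -(ler_pXn2r (n := 2)) ?nnegrE ?sqrtr_ge0// ?divr_ge0 ?mulr_ge0// ?(ltW s0)//.
      rewrite sqr_sqrtr// !exprMn real_normK ?num_real//.
      have -> : c ^+ 2 = 1 - s ^+ 2 by rewrite -cs; ring.
      rewrite exprVn ler_pdivrMr ?exprn_gt0//. nra.
    rewrite [RHS]integral_mkcond; apply: eq_integral => x _.
    rewrite !patchE.
    have eqv : ((x, y) \in sector n `&` D) = (x \in `[`|y| * c / s, Num.sqrt (1 - y ^+ 2)]%classic).
      apply/idP/idP; rewrite !inE /sector /unit_disc/= in_itv/= -/s -/c ler_pdivrMr//.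
        move=> [xs xD]; rewrite xs/=.
        have x0 : 0 <= x by rewrite -(pmulr_lge0 _ s0) (le_trans _ xs)// mulr_ge0.
        rewrite -(ler_pXn2r (n := 2)) ?nnegrE ?sqrtr_ge0// sqr_sqrtr//; lra.
      move=> /andP[xs xq]; split => //.
      have x0 : 0 <= x by rewrite -(pmulr_lge0 _ s0) (le_trans _ xs)// mulr_ge0.
      by move: xq; rewrite -(ler_pXn2r (n := 2)) ?nnegrE ?sqrtr_ge0// sqr_sqrtr//; lra.
    rewrite eqv; case: ifPn => //; rewrite inE/= in_itv/= => /andP[x1 _].
    by rewrite ger0_norm// (le_trans _ x1)// divr_ge0 ?mulr_ge0// ltW.
  move=> yn; apply: integral0_eq => x _; rewrite patchE memNset// => -[].
  rewrite /sector /unit_disc/= -/s -/c => xs xD; move/negP: yn; apply.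
  rewrite inE/= in_itv/= -ler_norml.
  have x0 : 0 <= x by rewrite -(pmulr_lge0 _ s0) (le_trans _ xs)// mulr_ge0.
  rewrite -(ler_pXn2r (n := 2)) ?nnegrE ?(ltW s0)//.
  have : (`|y| * c) ^+ 2 <= (x * s) ^+ 2.
    by rewrite ler_pXn2r// ?nnegrE ?mulr_ge0// ltW.
  rewrite !exprMn real_normK ?num_real//.
  have -> : c ^+ 2 = 1 - s ^+ 2 by rewrite -cs; ring.
  by nra.
rewrite (_ : \int[leb]_(y in _) _ = (4 / 2 * s / 3)%R%:E)%E.
  rewrite -EFinM; congr (_%:E).
  by move: (pi) (pi_gt0 R) => p p0; field; rewrite gt_eqF.
pose F (y : R) := (y - y ^+ 3 / (3 * s ^+ 2)) / 2.
rewrite (_ : 4 / 2 * s / 3 = F s - F (- s))//; last first.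
  by rewrite /F; field; rewrite gt_eqF.
apply: integral_antiderivative.
- by rewrite ge0_cp// ltW.
- move=> y; apply: cvgM; last exact: cvg_cst.
  by apply: cvgB; [exact: cvg_cst|apply: cvgM; [exact: exprn_continuous|exact: cvg_cst]].
- move=> y; rewrite /F; apply: is_derive_eq; rewrite /GRing.scale/=; field.
  by rewrite gt_eqF.
Qed.

(** Only points with [x.1 <= a] contribute, and [a <= cos (pi / n)] keeps that part of the sector
    inside the disc. The region is thus a triangle with vertical slices of length
    [2 x tan (pi / n)]. *)
Lemma integral_sector_triangle n a : (2 < n)%N -> 0 <= a <= cos (pi / n%:R) ->
  (\int[P]_(x in sector n) (Num.max (a - x.1) 0)%:E =
   (tan (pi / n%:R) * a ^+ 3 / (3 * pi))%:E)%E.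
Proof.
move=> n2 /andP[a0]; rewrite /tan; set s := sin _; set c := cos (pi / n%:R : R) => ac.
have n1 := ltnW n2.
have s0 : 0 < s by exact: sin_pi_div_gt0.
have c0 : 0 < c.
  apply: cos_gt0_pihalf; apply/andP; split.
    by rewrite (@lt_trans _ _ 0)// ?oppr_lt0 ?divr_gt0 ?pi_gt0// ltr0n ltnW// ltnW.
  by rewrite ltr_pM2l ?pi_gt0// ltf_pV2 ?posrE// ?ltr_nat// ltr0n ltnW// ltnW.
have cs : c ^+ 2 + s ^+ 2 = 1 by exact: cos2Dsin2.
have mS := measurable_sector (R := R) n.
have mSD : measurable (sector n `&` D : set (plane R)).
  by apply: measurableI => //; exact: measurable_unit_disc.
have mf : measurable_fun setT (fun x : plane R => (Num.max (a - x.1) 0)%:E).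
  apply/measurable_EFinP; apply: measurable_maxr => //.
  exact: measurable_funB.
have m0 (x : R) : 0 <= Num.max (a - x) 0 by rewrite le_max lexx orbT.
rewrite (uniform_disc_integral P_uniform)//; last by move=> x; rewrite lee_fin.
rewrite integral_mkcond fubini_tonelli1//=; last 2 first.
- by apply/(measurable_restrictT _ mSD); exact: measurable_funTS.
- by move=> x; apply: erestrict_ge0 => ? _; rewrite lee_fin.
pose f (x : R) := (a - x) * (2 * (x * (s / c))).
transitivity ((pi^-1)%:E * \int[leb]_(x in `[0%R, a]) (f x)%:E)%E.
  congr (_ * _)%E; rewrite [RHS]integral_mkcond; apply: eq_integral => x _.
  rewrite /fubini_F patchE.
  have [xa|xa] := ltP a x.
    rewrite memNset; last by rewrite /= in_itv/= => /andP[_]; rewrite leNgt xa.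
    apply: integral0_eq => y _; rewrite patchE; case: ifP => //= _.
    by rewrite max_r// subr_le0 ltW.
  case: ifPn => [|xn].
    rewrite inE/= in_itv/= => /andP[x0 _].
    have t0 : 0 <= x * (s / c) by rewrite mulr_ge0// divr_ge0// ltW.
    transitivity (\int[leb]_(y in `[(- (x * (s / c)))%R, (x * (s / c))%R]) cst (a - x)%R%:E y)%E.
      rewrite [RHS]integral_mkcond; apply: eq_integral => y _; rewrite !patchE/=.
      rewrite max_l ?subr_ge0//; congr (if _ then _ else _).
      apply/idP/idP; rewrite !inE /sector /unit_disc/= in_itv/= -/s -/c -ler_norml mulrA ler_pdivlMr//.
        by case.
      move=> ys; split => //.
      (* Squaring gives [(x^2 + y^2) c^2 <= x^2], and [x <= a <= c] then places the point in the
         disc. *)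
      have : (`|y| * c) ^+ 2 <= (x * s) ^+ 2.
        by rewrite ler_pXn2r// ?nnegrE ?mulr_ge0// ltW.
      rewrite !exprMn real_normK ?num_real//.
      have -> : s ^+ 2 = 1 - c ^+ 2 by rewrite -cs; ring.
      have : x ^+ 2 <= c ^+ 2 by rewrite ler_pXn2r ?nnegrE ?(ltW c0)// (le_trans xa).
      by move=> h1 h2; rewrite -(ler_pM2r (exprn_gt0 2 c0)); nra.
    rewrite integral_cst//= lebesgue_measure_itv/= lte_fin.
    case: ifPn => [_|].
      by rewrite -EFinB -EFinM; congr (_%:E); rewrite /f; ring.
    rewrite -leNgt => h; rewrite mule0 /f; congr (_%:E).
    by rewrite (_ : x * (s / c) = 0); [ring|lra].
  apply: integral0_eq => y _; rewrite patchE memNset// => -[].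
  rewrite /sector/= -/s -/c => xs _; move/negP: xn; apply.
  rewrite inE/= in_itv/= xa andbT -(pmulr_lge0 _ s0) (le_trans _ xs)// mulr_ge0//.
  exact: ltW.
pose F (x : R) := (a * x ^+ 2 - 2 / 3 * x ^+ 3) * (s / c).
rewrite (_ : \int[leb]_(x in _) _ = (F a - F 0)%R%:E)%E.
  rewrite -EFinM; congr (_%:E); rewrite /F.
  by move: (pi) (pi_gt0 R) => p p0; field; rewrite (gt_eqF p0) (gt_eqF c0).
apply: integral_antiderivative => //.
- move=> x; rewrite /f; apply: cvgM; first by apply: cvgB; [exact: cvg_cst|exact: cvg_id].
  by apply: cvgM; [exact: cvg_cst|apply: cvgM; [exact: cvg_id|exact: cvg_cst]].
- move=> x; rewrite /F /f; apply: is_derive_eq; rewrite /GRing.scale/=; field.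
  by rewrite gt_eqF.
Qed.

End disc_integrals.

(** * The second moment of the disc *)

Section second_moment.
Context {R : realType} (P : probability (plane R) R).
Hypothesis P_uniform : is_uniform_disc P.
Notation leb := (@lebesgue_measure R).
Local Notation D := (@unit_disc R).

(** The length of a vertical slice of the disc. As [Num.sqrt] is zero on negative numbers, it is
    continuous on the whole line and vanishes outside [[-1, 1]]. *)
Definition chord (x : R) : R := 2 * Num.sqrt (1 - x ^+ 2).

Lemma integral_fst_fun (g : R -> R) : measurable_fun setT g -> (forall x, 0 <= g x) ->
  (\int[P]_x (g x.1)%:E =
   pi^-1%:E * \int[leb]_(x in `[(-1)%R, 1%R]) (g x * chord x)%R%:E)%E.
Proof.
move=> mg g0.
have mD : measurable (D : set (plane R)) by exact: measurable_unit_disc.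
have mf : measurable_fun setT (fun x : plane R => (g x.1)%:E).
  by apply/measurable_EFinP; exact: measurableT_comp.
rewrite (uniform_disc_integral P_uniform)//; last by move=> x; rewrite lee_fin.
rewrite setTI integral_mkcond fubini_tonelli1//=; last 2 first.
- by apply/(measurable_restrictT _ mD); exact: measurable_funTS.
- by move=> x; apply: erestrict_ge0 => ? _; rewrite lee_fin.
congr (_ * _)%E; rewrite [RHS]integral_mkcond; apply: eq_integral => x _.
rewrite /fubini_F patchE; case: ifPn => [|xn].
  rewrite inE/= in_itv/= => /andP[x1 x2].
  have q0 : 0 <= 1 - x ^+ 2 by nra.
  transitivity (\int[leb]_(y in `[(- Num.sqrt (1 - x ^+ 2))%R, (Num.sqrt (1 - x ^+ 2))%R])
      cst (g x)%:E y)%E.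
    rewrite [RHS]integral_mkcond; apply: eq_integral => y _; rewrite !patchE/=.
    congr (if _ then _ else _).
    have ey : (`|y| <= Num.sqrt (1 - x ^+ 2)) = (y ^+ 2 <= 1 - x ^+ 2).
      rewrite -[LHS](ler_pXn2r (n := 2)) ?nnegrE ?sqrtr_ge0//.
      by rewrite sqr_sqrtr// real_normK ?num_real.
    apply/idP/idP; rewrite !inE /unit_disc/= in_itv/= -ler_norml ey; lra.
  rewrite integral_cst//= lebesgue_measure_itv/= lte_fin.
  case: ifPn => [_|].
    by rewrite -EFinB -EFinM; congr (_%:E); rewrite /chord; ring.
  rewrite -leNgt => h; rewrite mule0 /chord; congr (_%:E).
  have := sqrtr_ge0 (1 - x ^+ 2).
  by move: h; set q := Num.sqrt _ => h h2; rewrite (_ : q = 0); [ring|lra].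
apply: integral0_eq => y _; rewrite patchE memNset// /unit_disc/= => xD.
move/negP: xn; apply; rewrite inE/= in_itv/= -ler_norml.
by rewrite -(ler_pXn2r (n := 2)) ?nnegrE// real_normK ?num_real//; nra.
Qed.

Lemma continuous_chord : continuous chord.
Proof.
move=> x; apply: cvgM; first exact: cvg_cst.
apply: (@continuous_comp _ _ _ (fun x : R => 1 - x ^+ 2) Num.sqrt); last exact: sqrt_continuous.
by apply: cvgB; [exact: cvg_cst|exact: exprn_continuous].
Qed.

Lemma chord_ge0 x : 0 <= chord x.
Proof. by rewrite mulr_ge0// sqrtr_ge0. Qed.

(* [(1 - 4 x^2) chord x] is the derivative of [x (1 - x^2) chord x]. *)
Lemma integral_chord_sqr :
  (\int[leb]_(x in `[(-1)%R, 1%R]) ((1 - 4 * x ^+ 2) * chord x)%R%:E = 0)%E.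
Proof.
pose F (x : R) := x * (1 - x ^+ 2) * chord x.
have -> : 0%E = ((F 1)%:E - (F (-1))%:E)%E.
  by rewrite -EFinB /F sqrrN expr1n subrr !mulr0 !mul0r subrr.
have cpoly (k : R) : continuous (fun x : R => 1 - k * x ^+ 2).
  move=> x; apply: cvgB; first exact: cvg_cst.
  by apply: cvgM; [exact: cvg_cst|exact: exprn_continuous].
have cF : continuous F.
  move=> x; apply: cvgM; last exact: continuous_chord.
  apply: cvgM; first exact: cvg_id.
  by apply: cvgB; [exact: cvg_cst|exact: exprn_continuous].
(* The square root is not differentiable at the endpoints; there the continuity of [F] suffices. *)
have dF (x : R) : -1 < x < 1 -> is_derive x 1 F ((1 - 4 * x ^+ 2) * chord x).
  move=> /andP[x1 x2]; have q0 : 0 < 1 - x ^+ 2 by nra.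
  have d1 : is_derive x 1 (fun x : R => 1 - x ^+ 2) (- (2 * x)).
    by apply: is_derive_eq; rewrite /GRing.scale/=; ring.
  have d2 : is_derive (1 - x ^+ 2) 1 Num.sqrt (2 * Num.sqrt (1 - x ^+ 2))^-1.
    exact: is_derive1_sqrt.
  have d3 := @is_derive1_comp _ Num.sqrt (fun x : R => 1 - x ^+ 2) x _ _ d2 d1.
  rewrite /F /chord; apply: (@is_derive_eq _ _ _ _ _ _ _ _ (is_deriveM _ (is_deriveM _ d3))).
  rewrite /GRing.scale/=.
  have e : Num.sqrt (1 - x ^+ 2) ^+ 2 = 1 - x ^+ 2 by rewrite sqr_sqrtr// ltW.
  have s0 : 0 < Num.sqrt (1 - x ^+ 2) by rewrite sqrtr_gt0.
  move: e s0; set q := Num.sqrt _ => e s0.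
  apply: (mulfI (lt0r_neq0 s0)).
  have -> : ((fun=> 2) * (Num.sqrt \o (fun x0 : R => 1 - x0 ^+ 2))) x = 2 * q by [].
  transitivity (2 * q ^+ 2 * (q ^+ 2 - 3 * x ^+ 2)).
    by rewrite -e; field; rewrite gt_eqF.
  have -> : x ^+ 2 = 1 - q ^+ 2 by rewrite e; ring.
  ring.
apply: continuous_FTC2.
- by rewrite gtrN.
- apply: continuous_subspaceT => x.
  apply: cvgM; last exact: continuous_chord.
  exact: cpoly.
- split => [x|/=|/=].
  + rewrite in_itv/= => /dF d; exact: (@ex_derive _ _ _ _ _ _ _ d).
  + exact/cvg_at_right_filter/cF.
  + exact/cvg_at_left_filter/cF.
- by move=> x; rewrite in_itv/= => /dF d; rewrite derive1E; apply: derive_val.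
Qed.

(** Total mass one says that [chord] integrates to [pi]; by [integral_chord_sqr] this is four times
    the integral of [x^2 chord x]. The area of the disc thus comes from [P] being a probability. *)
Lemma uniform_disc_fst_sqr : (\int[P]_x (x.1 ^+ 2)%:E = (4^-1)%R%:E)%E.
Proof.
have p0 := pi_gt0 R.
have m1 : measurable_fun setT (fun x : R => x ^+ 2) by exact: measurable_funX.
have s0 (x : R) : 0 <= x ^+ 2 by exact: sqr_ge0.
rewrite (@integral_fst_fun (fun x => x ^+ 2))//.
have := @integral_fst_fun (cst 1) (measurable_cst _) (fun=> ler01).
have -> : (\int[P]_x ((cst 1 : R -> R) x.1)%:E = 1)%E.
  transitivity (\int[P]_x cst 1%E x)%E; first by [].
  by rewrite integral_cst// mul1e; exact: (probability_setT P).
set I1 := integral _ _ _; set I2 := integral _ _ _ => e.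
have int (f : R -> R) : continuous f -> leb.-integrable `[(-1)%R, 1%R] (EFin \o f).
  move=> cf; apply: continuous_compact_integrable; first exact: segment_compact.
  exact: continuous_subspaceT.
have cc := continuous_chord.
have cx : continuous (fun x : R => x ^+ 2 * chord x).
  by move=> x; apply: cvgM; [exact: exprn_continuous|exact: cc].
have e2 : (I1 = 4%:E * I2)%E.
  rewrite /I2 -integralZl//; last exact: int.
  rewrite -[RHS]add0e -integral_chord_sqr -integralD//=; last 2 first.
  - apply: int => x; apply: cvgM; last exact: cc.
    apply: cvgB; first exact: cvg_cst.
    by apply: cvgM; [exact: cvg_cst|exact: exprn_continuous].
  - apply: (int (fun x => 4 * (x ^+ 2 * chord x))) => x.
    by apply: cvgM; [exact: cvg_cst|exact: cx].
  apply: eq_integral => x _; rewrite -EFinM -EFinD; rewrite /cst; congr (_%:E); ring.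
have I20 : (0 <= I2)%E.
  by apply: integral_ge0 => x _; rewrite lee_fin mulr_ge0// chord_ge0.
have : I2 \is a fin_num by apply: integrable_fin_num; [|exact: int].
move: e; rewrite e2; case: I2 {e2 I20} => [r| |]//.
rewrite -!EFinM => -[e] _; congr (_%:E).
by apply: (@mulfI _ 4) => //; rewrite mulfV// [RHS]e mulrCA.
Qed.

(** A quarter turn exchanges the squares of the two coordinates, so both have the same mean. *)
Lemma uniform_disc_sqr_norm : (\int[P]_x (x.1 ^+ 2 + x.2 ^+ 2)%:E = (2^-1)%R%:E)%E.
Proof.
under eq_integral do rewrite EFinD.
have m1 : measurable_fun setT (fun x : plane R => x.1 ^+ 2) by exact: measurable_funX.
have m2 : measurable_fun setT (fun x : plane R => x.2 ^+ 2) by exact: measurable_funX.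
rewrite ge0_integralD//; last 4 first.
- by move=> x _; rewrite lee_fin sqr_ge0.
- exact/measurable_EFinP.
- by move=> x _; rewrite lee_fin sqr_ge0.
- exact/measurable_EFinP.
have -> : (\int[P]_x (x.2 ^+ 2)%:E = \int[P]_x (x.1 ^+ 2)%:E)%E.
  rewrite [RHS](integral_rot P_uniform (pi / 2))//.
  - rewrite preimage_setT; apply: eq_integral => x _.
    by rewrite /rotation/= cos_pihalf sin_pihalf; congr (_%:E); ring.
  - exact/measurable_EFinP.
  - by move=> x; rewrite lee_fin sqr_ge0.
rewrite uniform_disc_fst_sqr -EFinD; congr (_%:E); by field.
Qed.

End second_moment.

(** * Existence of optimal sets *)

Section distance.
Context {R : realType}.
Implicit Types (x : R * R) (v : nat -> R * R).

Definition dist_set (alpha : set (R * R)) x : \bar R :=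
  ereal_inf [set (sqdist x a)%:E | a in alpha].

Lemma sqdist_ge0 x y : 0 <= sqdist x y.
Proof. by rewrite addr_ge0// sqr_ge0. Qed.

Lemma measurable_sqdist y : measurable_fun setT (fun x : plane R => sqdist x y).
Proof.
by apply: measurable_funD; apply: measurable_funX; apply: measurable_funB.
Qed.

Lemma dist_setP alpha x (d : R) : (exists2 a, alpha a & sqdist x a = d) ->
  (forall a, alpha a -> d <= sqdist x a) -> dist_set alpha x = d%:E.
Proof.
move=> [a aa ad] dmin; apply/eqP; rewrite eq_le; apply/andP; split.
  by apply: ereal_inf_lbound; exists a => //; rewrite ad.
by apply: le_ereal_inf_tmp => _ [b bb <-]; rewrite lee_fin dmin.
Qed.

Lemma dist_set_ge alpha x (d : R) :
  (forall a, alpha a -> d <= sqdist x a) -> (d%:E <= dist_set alpha x)%E.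
Proof. by move=> dmin; apply: le_ereal_inf_tmp => _ [b bb <-]; rewrite lee_fin dmin. Qed.

Lemma dist_set_ge0 alpha x : (0 <= dist_set alpha x)%E.
Proof. by apply: dist_set_ge => a _; exact: sqdist_ge0. Qed.

(** Indexed families may repeat points, which matches the bound [card <= n]. For positive [n] the
    default value is itself one of the distances, so it does not affect the minimum. *)
Definition nearest v n x := \big[Order.min/sqdist x (v 0%N)]_(i < n) sqdist x (v i).

Lemma nearest_le v n x k : (k < n)%N -> nearest v n x <= sqdist x (v k).
Proof. by move=> kn; apply: (bigmin_le _ (Ordinal kn)). Qed.

Lemma nearest_attained v n x : (0 < n)%N ->
  exists2 k, (k < n)%N & nearest v n x = sqdist x (v k).
Proof.
move=> n0; rewrite /nearest.
apply: (big_ind (fun d => exists2 k, (k < n)%N & d = sqdist x (v k))).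
- by exists 0%N.
- by move=> d e dE eE; rewrite minEle; case: ifPn.
- by move=> i _; exists i.
Qed.

Lemma dist_set_image v n x : (0 < n)%N ->
  dist_set (v @` `I_n) x = (nearest v n x)%:E.
Proof.
move=> n0; apply: dist_setP.
- by have [k kn e] := nearest_attained v x n0; exists (v k) => //; exists k.
- by move=> _ [k kn <-]; exact: nearest_le.
Qed.

Lemma measurable_nearest v n :
  measurable_fun setT (nearest v n : plane R -> R).
Proof.
rewrite /nearest; elim: (index_enum _) => [|i s ih].
  by under eq_fun do rewrite big_nil; exact: measurable_sqdist.
under eq_fun do rewrite big_cons; apply: measurable_minr => //.
exact: measurable_sqdist.
Qed.

(** Indices that the partial surjection sends outside [alpha] are redirected to a fixed element of
    [alpha]. *)
Lemma card_le_II_image (alpha : set (R * R)) n :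
  (alpha #<= `I_n)%card -> alpha !=set0 -> exists v, alpha = v @` `I_n.
Proof.
move=> /pcard_surjP[g gsurj] [a aa].
exists (fun k => if `[< alpha (g k) >] then g k else a).
apply/seteqP; split => [b bb|_ [k kn <-]].
  by have [k kn gk] := gsurj b bb; exists k => //; rewrite asboolT gk.
by case: asboolP.
Qed.

Lemma card_image_II v n : (v @` `I_n #<= `I_n)%card.
Proof. exact: card_image_le. Qed.

End distance.

(** * Compactness and attainment of the infimum *)

Section existence.
Context {R : realType} (P : probability (plane R) R).
Hypothesis P_uniform : is_uniform_disc P.
Local Notation D := (@unit_disc R).

Lemma distortionE (alpha : set (R * R)) :
  distortion P alpha = (\int[P]_x dist_set alpha x)%E.
Proof. by []. Qed.

Lemma distortion_image v n : (0 < n)%N ->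
  distortion P (v @` `I_n) = (\int[P]_x (nearest v n x)%:E)%E.
Proof. by move=> n0; apply: eq_integral => x _; exact: dist_set_image. Qed.

Lemma nearest_ge0 v n x : (0 < n)%N -> 0 <= nearest v n x :> R.
Proof. by move=> /(nearest_attained v x)[k _ ->]; exact: sqdist_ge0. Qed.

Lemma le_integral_disc (f g : plane R -> R) : measurable_fun setT f ->
  measurable_fun setT g -> (forall x, 0 <= f x) -> (forall x, 0 <= g x) ->
  (forall x, D x -> f x <= g x) ->
  (\int[P]_x (f x)%:E <= \int[P]_x (g x)%:E)%E.
Proof.
move=> mf mg f0 g0 fg; have mD : measurable (D : set (plane R)) := measurable_unit_disc.
rewrite (integral_setI_disc P_uniform)//; [|exact/measurable_EFinP].
rewrite [leRHS](integral_setI_disc P_uniform)//; [|exact/measurable_EFinP].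
rewrite setTI; apply: ge0_le_integral => //.
- by move=> x _; rewrite lee_fin.
- by apply: measurable_funTS; exact/measurable_EFinP.
- by apply: measurable_funTS; exact/measurable_EFinP.
Qed.

Lemma unit_disc_bounds (x : R * R) : D x ->
  [/\ -1 <= x.1, x.1 <= 1, -1 <= x.2 & x.2 <= 1].
Proof.
rewrite /unit_disc/= => xD; have := sqr_ge0 x.1; have := sqr_ge0 x.2.
by move=> h1 h2; split; nra.
Qed.

Definition clamp (t : R) : R := if t < -1 then -1 else if 1 < t then 1 else t.
Definition clamp2 (x : R * R) : R * R := (clamp x.1, clamp x.2).

Lemma clampP t : -1 <= clamp t <= 1.
Proof.
by rewrite /clamp; case: (ltP t (-1)) => ?; case: (ltP 1 t) => ?; apply/andP; split; lra.
Qed.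

Lemma clamp_id t : -1 <= t <= 1 -> clamp t = t.
Proof.
by move=> /andP[? ?]; rewrite /clamp; case: (ltP t (-1)) => ?; case: (ltP 1 t) => ?; lra.
Qed.

Lemma clamp_lipschitz s t : `|clamp s - clamp t| <= `|s - t|.
Proof.
have := ler_norm (s - t); have := ler_norm (t - s); rewrite (distrC t) => h1 h2.
rewrite ler_norml /clamp; case: (ltP s (-1)) => ?; case: (ltP 1 s) => ?;
  case: (ltP t (-1)) => ?; case: (ltP 1 t) => ?; apply/andP; split; lra.
Qed.

Lemma sqr_sub_clamp_le s t : -1 <= s <= 1 -> (s - clamp t) ^+ 2 <= (s - t) ^+ 2.
Proof.
move=> h; rewrite -[leLHS]real_normK ?num_real// -[leRHS]real_normK ?num_real//.
rewrite ler_pXn2r ?nnegrE//.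
by have := clamp_lipschitz s t; rewrite (clamp_id h).
Qed.

(** Clamping is 1-Lipschitz and fixes the coordinates of points of the disc. *)
Lemma sqdist_clamp_le x a : D x -> sqdist x (clamp2 a) <= sqdist x a.
Proof.
move=> /unit_disc_bounds[x1 x2 x3 x4].
by apply: lerD; apply: sqr_sub_clamp_le; apply/andP.
Qed.

(** The difference of the squares is [(t - s) (2 x - s - t)], and the second factor is at most 4 in
    absolute value. *)
Lemma sqr_sub_lipschitz (x s t e : R) : -1 <= x <= 1 -> -1 <= s <= 1 ->
  -1 <= t <= 1 -> `|s - t| <= e -> (x - s) ^+ 2 <= (x - t) ^+ 2 + 4 * e.
Proof. rewrite ler_norml => ? ? ? /andP[? ?]; nra. Qed.

Lemma nearest_clamp_lipschitz v w n x e : (0 < n)%N -> D x ->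
  (forall k, (k < n)%N -> `|(v k).1 - (w k).1| <= e /\ `|(v k).2 - (w k).2| <= e) ->
  nearest (clamp2 \o v) n x <= nearest (clamp2 \o w) n x + 8 * e.
Proof.
move=> n0 /unit_disc_bounds[x1 x2 x3 x4] vw.
have [k kn ->] := nearest_attained (clamp2 \o w) x n0.
apply: le_trans (nearest_le _ _ kn) _.
have [e1 e2] := vw _ kn.
have l s t : `|s - t| <= e -> `|clamp s - clamp t| <= e.
  exact: le_trans (clamp_lipschitz _ _).
have h1 := @sqr_sub_lipschitz x.1 _ _ e _ (clampP _) (clampP _) (l _ _ e1).
have h2 := @sqr_sub_lipschitz x.2 _ _ e _ (clampP _) (clampP _) (l _ _ e2).
rewrite /sqdist/= (_ : 8 * e = 4 * e + 4 * e); last by ring.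
by rewrite addrACA lerD ?h1 ?h2//; apply/andP.
Qed.

Let G v n := (\int[P]_x (nearest (clamp2 \o v) n x)%:E)%E.

Lemma integral_clamp_lipschitz v w n e : (0 < n)%N -> 0 <= e ->
  (forall k, (k < n)%N -> `|(v k).1 - (w k).1| <= e /\ `|(v k).2 - (w k).2| <= e) ->
  (G v n <= G w n + (8 * e)%:E)%E.
Proof.
move=> n0 e0 vw.
have <- : (\int[P]_x (nearest (clamp2 \o w) n x + 8 * e)%R%:E = G w n + (8 * e)%:E)%E.
  under eq_integral do rewrite EFinD.
  have mN : measurable_fun setT (fun x : plane R => (nearest (clamp2 \o w) n x)%:E).
    by apply/measurable_EFinP; exact: measurable_nearest.
  have N0 (x : plane R) : (0 <= (nearest (clamp2 \o w) n x)%:E)%E.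
    by rewrite lee_fin nearest_ge0.
  have e80 : (0 <= (8 * e)%R%:E)%E by rewrite lee_fin mulr_ge0.
  rewrite ge0_integralD//; congr (_ + _)%E.
  transitivity (\int[P]_x cst (8 * e)%R%:E x)%E; first by [].
  by rewrite integral_cst// [X in (_ * X)%E](probability_setT P) mule1.
apply: le_integral_disc.
- exact: measurable_nearest.
- by apply: measurable_funD => //; exact: measurable_nearest.
- by move=> x; exact: nearest_ge0.
- by move=> x; rewrite addr_ge0 ?nearest_ge0// mulr_ge0.
- by move=> x xD; exact: nearest_clamp_lipschitz.
Qed.

Lemma integral_clamp_fin_num v n : (0 < n)%N -> G v n \is a fin_num.
Proof.
move=> n0; rewrite ge0_fin_numE; last first.
  by apply: integral_ge0 => x _; rewrite lee_fin nearest_ge0.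
(* In the square [[-1, 1]^2] squared distances are at most [2^2 + 2^2 = 8]. *)
apply: (@le_lt_trans _ _ (\int[P]_x (cst 8%:E x))%E); last first.
  by rewrite integral_cst// [X in (_ * X)%E](probability_setT P) mule1 ltry.
apply: (@le_integral_disc _ (cst 8)) => //.
- exact: measurable_nearest.
- by move=> x; exact: nearest_ge0.
- move=> x /unit_disc_bounds[x1 x2 x3 x4].
  rewrite (le_trans (nearest_le _ _ n0))// /sqdist/=.
  have := clampP (v 0%N).1; have := clampP (v 0%N).2.
  by move: (clamp _) (clamp _) => s t /andP[? ?] /andP[? ?]; nra.
Qed.

(** By the Lipschitz estimate the clamped distortion is continuous in the coordinates, so it attains
    a minimum on a compact box. Families are encoded as two row vectors, one per coordinate. *)
Lemma integral_clamp_min n : (0 < n)%N -> exists v, forall w, (G v n <= G w n)%E.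
Proof.
move=> n0.
pose T : Type := ('rV[R]_n * 'rV[R]_n)%type.
pose fam (A : T) (k : nat) : R * R :=
  if insub k is Some i then (A.1 ord0 i, A.2 ord0 i) else (0, 0).
have famE A k (kn : (k < n)%N) :
    fam A k = (A.1 ord0 (Ordinal kn), A.2 ord0 (Ordinal kn)).
  by rewrite /fam insubT.
pose f A := fine (G (fam A) n).
have fE A : (f A)%:E = G (fam A) n by rewrite fineK// integral_clamp_fin_num.
pose box := [set A : 'rV[R]_n | forall i, `[-1, 1]%classic (A ord0 i)].
have cbox : compact box.
  exact: (@rV_compact R n (fun=> `[-1, 1]%classic) (fun=> @segment_compact R _ _)).
have flip (A B : T) e : 0 <= e -> (forall i, `|A.1 ord0 i - B.1 ord0 i| <= e /\
    `|A.2 ord0 i - B.2 ord0 i| <= e) -> f A <= f B + 8 * e.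
  move=> e0 AB; rewrite -lee_fin EFinD !fE; apply: integral_clamp_lipschitz => // k kn.
  by rewrite !famE; exact: AB.
have cf : continuous (f : 'rV[R]_n * 'rV[R]_n -> R).
  move=> A; apply/cvgrPdist_le => /= e e0.
  have e8 : 0 < e / 8 by rewrite divr_gt0.
  have := nbhsx_ballx A _ e8; apply: filterS => B [[_ AB1] [_ AB2]].
  have h i : `|A.1 ord0 i - B.1 ord0 i| <= e / 8 /\ `|A.2 ord0 i - B.2 ord0 i| <= e / 8.
    by have /ltW ? := AB1 ord0 i; have /ltW ? := AB2 ord0 i.
  have h1 := flip A B _ (ltW e8) h.
  have h2 : f B <= f A + 8 * (e / 8).
    apply: flip; first exact: ltW.
    by move=> i; rewrite distrC [X in _ /\ X <= _]distrC.
  have e1 : 8 * (e / 8) = e by field.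
  by move: h1 h2; rewrite e1 ler_norml => h1 h2; apply/andP; split; lra.
have [|A _ Amin] := @compact_EVT_min _ _ (f : 'rV[R]_n * 'rV[R]_n -> R) _ _
    (compact_setX cbox cbox) (continuous_subspaceT cf).
  have z : box 0 by move=> i; rewrite mxE /= in_itv/= lerN10 ler01.
  by exists (0, 0).
exists (fam A) => w.
(* Clamping is idempotent, so an arbitrary [w] has the same clamped distortion as a point of the
   box. *)
pose B : T := (\row_i clamp (w i).1, \row_i clamp (w i).2).
have -> : G w n = (f B)%:E.
  rewrite fE; apply: eq_integral => x _; congr (_%:E).
  have famB k : (k < n)%N -> clamp2 (fam B k) = clamp2 (w k).
    by move=> kn; rewrite famE /clamp2/= !mxE !(clamp_id (clampP _)).
  rewrite /nearest/= famB//.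
  by apply: eq_bigr => i _; rewrite /= famB.
rewrite -fE lee_fin Amin// inE; split => i; rewrite mxE /= in_itv/=; exact: clampP.
Qed.

Lemma optimal_means_exist n : (0 < n)%N -> exists alpha, optimal_means P n alpha.
Proof.
move=> n0; have [v vmin] := integral_clamp_min n0.
exists ((clamp2 \o v) @` `I_n); split; first exact: card_image_II.
apply/eqP; rewrite eq_le; apply/andP; split; last first.
  apply: ereal_inf_lbound; exists ((clamp2 \o v) @` `I_n) => //.
  exact: card_image_II.
apply: le_ereal_inf_tmp => _ [alpha alphan <-].
(* The cardinality bound admits the empty set, whose distortion is [+oo]. *)
have [->|/set0P alpha0] := eqVneq alpha set0.
  rewrite {2}/distortion [leRHS](_ : _ = +oo%E) ?leey//.
  transitivity (\int[P]_x cst +oo%E x)%E.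
    by apply: eq_integral => x _; rewrite image_set0 ereal_inf0.
  by rewrite integral_cst// [X in (_ * X)%E](probability_setT P) mule1.
have [w ->] := card_le_II_image alphan alpha0.
rewrite !distortion_image//; apply: le_trans (vmin w) _.
apply: le_integral_disc.
- exact: measurable_nearest.
- exact: measurable_nearest.
- by move=> x; exact: nearest_ge0.
- by move=> x; exact: nearest_ge0.
- move=> x xD; have [k kn ->] := nearest_attained w x n0.
  apply: le_trans (nearest_le _ _ kn) _; exact: sqdist_clamp_le.
Qed.

End existence.

(** * Distortion of regular polygons *)

Section ngon.
Context {R : realType}.
Implicit Types (x : R * R) (r t b : R) (n k : nat).

Definition origin : set (R * R) := [set (0, 0)].

Lemma sqdist_polar x r b :
  sqdist x (0 + r * cos b, 0 + r * sin b) =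
  x.1 ^+ 2 + x.2 ^+ 2 + r ^+ 2 - 2 * r * dirproj b x.
Proof.
rewrite /sqdist /dirproj/=.
transitivity (x.1 ^+ 2 + x.2 ^+ 2 + r ^+ 2 * (cos b ^+ 2 + sin b ^+ 2)
  - 2 * r * (x.1 * cos b + x.2 * sin b)); first by ring.
by rewrite cos2Dsin2 mulr1.
Qed.

Lemma sqnorm_rotation t x :
  (rotation t x).1 ^+ 2 + (rotation t x).2 ^+ 2 = x.1 ^+ 2 + x.2 ^+ 2.
Proof.
rewrite /rotation/=.
transitivity ((x.1 ^+ 2 + x.2 ^+ 2) * (cos t ^+ 2 + sin t ^+ 2)); first by ring.
by rewrite cos2Dsin2 mulr1.
Qed.

(** The flag [c] adds the origin, so that both kinds of configuration share the symmetry
    arguments. *)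
Definition shape (c : bool) n r t : set (R * R) :=
  (if c then origin else set0) `|` ngon n (0, 0) r t.

Lemma dist_set_rotation (c : bool) n r t s x :
  dist_set (shape c n r (s + t)) (rotation s x) = dist_set (shape c n r t) x.
Proof.
have e k : sqdist (rotation s x)
    (0 + r * cos (s + t + 2 * pi * k%:R / n%:R), 0 + r * sin (s + t + 2 * pi * k%:R / n%:R))
  = sqdist x (0 + r * cos (t + 2 * pi * k%:R / n%:R), 0 + r * sin (t + 2 * pi * k%:R / n%:R)).
  rewrite !sqdist_polar sqnorm_rotation dirproj_rotation; congr (_ - _ * dirproj _ _); ring.
have e0 : sqdist (rotation s x) (0, 0) = sqdist x (0, 0).
  by rewrite /sqdist/= !subr0 sqnorm_rotation.
rewrite /dist_set/=; congr ereal_inf; apply/seteqP; split => _ [a aa <-].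
- case: aa => [|[k kn <-]].
    case: c => // ->; exists (0, 0); first by left.
    by rewrite e0.
  exists (0 + r * cos (t + 2 * pi * k%:R / n%:R), 0 + r * sin (t + 2 * pi * k%:R / n%:R)).
    by right; exists k.
  by rewrite -e.
- case: aa => [|[k kn <-]].
    case: c => // ->; exists (0, 0); first by left.
    by rewrite e0.
  exists (0 + r * cos (s + t + 2 * pi * k%:R / n%:R), 0 + r * sin (s + t + 2 * pi * k%:R / n%:R)).
    by right; exists k.
  by rewrite -e.
Qed.

Lemma ngon_shift n (o : R * R) r : (0 < n)%N -> ngon n o r (2 * pi / n%:R) = ngon n o r 0.
Proof.
move=> n0; have nr : n%:R != 0 :> R by rewrite pnatr_eq0 -lt0n.
have p2 b : cos (b + 2 * pi) = cos b /\ sin (b + 2 * pi) = sin b.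
  by rewrite mulr_natl cosD2pi sinD2pi.
have full : 2 * pi / n%:R + 2 * pi * (n.-1)%:R / n%:R = 0 + 2 * pi * 0%:R / n%:R + 2 * pi :> R.
  by rewrite -subn1 natrB//; field.
apply/seteqP; split => _ [k kn <-].
- have [k1|k1] := ltnP k.+1 n.
    exists k.+1 => //; rewrite -(@natr1 _ k).
    by have -> : 0 + 2 * pi * (k%:R + 1) / n%:R = 2 * pi / n%:R + 2 * pi * k%:R / n%:R :> R by ring.
  exists 0%N => //; have -> : k = n.-1.
    by apply/eqP; rewrite eqn_leq -ltnS prednK// kn/= -ltnS prednK.
  by rewrite full (p2 _).1 (p2 _).2.
- case: k kn => [_|k kn].
    exists n.-1; first by rewrite /= prednK.
    by rewrite full (p2 _).1 (p2 _).2.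
  exists k; first exact: ltnW.
  rewrite -(@natr1 _ k).
  by have -> : 0 + 2 * pi * (k%:R + 1) / n%:R = 2 * pi / n%:R + 2 * pi * k%:R / n%:R :> R by ring.
Qed.

Lemma finite_ngon n (o : R * R) r t : finite_set (ngon n o r t).
Proof. exact/finite_image/finite_II. Qed.

Lemma measurable_dist_set (alpha : set (R * R)) : finite_set alpha -> alpha !=set0 ->
  measurable_fun setT (dist_set alpha : plane R -> \bar R).
Proof.
move=> [n alphan] alpha0.
have [v e] : exists v, alpha = v @` `I_n.
  by apply: card_le_II_image => //; move: alphan; rewrite card_eq_le => /andP[].
have n0 : (0 < n)%N.
  by case: n e {alphan} => // e; case: alpha0 => a; rewrite e => -[].
rewrite (_ : dist_set alpha = fun x => (nearest v n x)%:E).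
  by apply/measurable_EFinP; exact: measurable_nearest.
by apply/funext => x; rewrite e dist_set_image.
Qed.

Lemma dist_set_ngon_sector n r x : (1 < n)%N -> 0 <= r -> sector n x ->
  dist_set (set0 `|` ngon n (0, 0) r 0) x =
  (x.1 ^+ 2 + x.2 ^+ 2 + r ^+ 2 - 2 * r * x.1)%:E.
Proof.
move=> n1 r0 xS; rewrite set0U; have n0 := ltnW n1; apply: dist_setP.
  exists (0 + r * cos (0 + 2 * pi * 0%:R / n%:R), 0 + r * sin (0 + 2 * pi * 0%:R / n%:R)).
    by exists 0%N.
  by rewrite sqdist_polar mulr0 mul0r addr0 dirproj0.
move=> _ [k kn <-]; rewrite sqdist_polar lerD2l lerN2 ler_wpM2l ?mulr_ge0//.
have := sector_proj_sub_le kn n0 xS.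
by rewrite /vertex_angle mulr0 mul0r subr0 add0r.
Qed.

(** In the sector only the origin and the first vertex compete. The origin wins when [x.1 < r / 2],
    saving [r^2 - 2 r x.1]. The saving is added on the left so that only nonnegative functions are
    integrated. *)
Lemma dist_set_centered_sector n r x : (1 < n)%N -> 0 <= r -> sector n x ->
  (dist_set (origin `|` ngon n (0, 0) r 0)%R x +
   (2 * r * Num.max (r / 2 - x.1) 0)%R%:E =
  (x.1 ^+ 2 + x.2 ^+ 2 + r ^+ 2 - 2 * r * x.1)%R%:E)%E.
Proof.
move=> n1 r0 xS; have n0 := ltnW n1.
have d0 : sqdist x (0, 0) = x.1 ^+ 2 + x.2 ^+ 2 by rewrite /sqdist/= !subr0.
have dk k : (k < n)%N -> x.1 ^+ 2 + x.2 ^+ 2 + r ^+ 2 - 2 * r * x.1 <=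
    sqdist x (0 + r * cos (0 + 2 * pi * k%:R / n%:R), 0 + r * sin (0 + 2 * pi * k%:R / n%:R)).
  move=> kn; rewrite sqdist_polar lerD2l lerN2 ler_wpM2l ?mulr_ge0//.
  have := sector_proj_sub_le kn n0 xS.
  by rewrite /vertex_angle mulr0 mul0r subr0 add0r.
have [h|h] := leP (r / 2 - x.1) 0.
- rewrite mulr0 adde0; apply: dist_setP.
    exists (0 + r * cos (0 + 2 * pi * 0%:R / n%:R), 0 + r * sin (0 + 2 * pi * 0%:R / n%:R)).
      by right; exists 0%N.
    by rewrite sqdist_polar mulr0 mul0r addr0 dirproj0.
  move=> _ [->|[k kn <-]]; last exact: dk.
  by rewrite d0; nra.
- rewrite (@dist_setP _ _ _ (x.1 ^+ 2 + x.2 ^+ 2)); first by rewrite -EFinD; congr (_%:E); field.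
    by exists (0, 0) => //; left.
  move=> _ [->|[k kn <-]]; first by rewrite d0.
  by apply: le_trans (dk k kn); nra.
Qed.

End ngon.

(** * Closed forms and bounds for the distortion *)

Section distortion_ngon.
Context {R : realType} (P : probability (plane R) R).
Hypothesis P_uniform : is_uniform_disc P.
Implicit Types (r t : R) (n : nat).

Lemma finite_shape c n r t : finite_set (shape c n r t).
Proof.
rewrite /shape finite_setU; split; last exact: finite_ngon.
by case: c; [exact: finite_set1|exact: finite_set0].
Qed.

Lemma shape_neq0 c n r t : (0 < n)%N -> shape c n r t !=set0.
Proof.
move=> n0; exists (0 + r * cos (t + 2 * pi * 0%:R / n%:R), 0 + r * sin (t + 2 * pi * 0%:R / n%:R)).
by right; exists 0%N.
Qed.

(** Rotation invariance of [P] removes the phase [t]; a turn by [2 pi / n] permutes the vertices, so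
    [integral_sector] applies. *)
Lemma distortion_shape_sector c n r t : (1 < n)%N ->
  distortion P (shape c n r t) =
  (n%:R%:E * \int[P]_(x in sector n) dist_set (shape c n r 0%R) x)%E.
Proof.
move=> n1; have n0 := ltnW n1.
have m u : measurable_fun setT (dist_set (shape c n r u) : plane R -> \bar R).
  by apply: measurable_dist_set; [exact: finite_shape|exact: shape_neq0].
rewrite distortionE (integral_rot P_uniform t)//; last by move=> x; exact: dist_set_ge0.
rewrite preimage_setT -(integral_sector P_uniform n1)//.
- by apply: eq_integral => x _; rewrite -(dist_set_rotation c n r 0 t) addr0.
- by move=> x; exact: dist_set_ge0.
- move=> x; rewrite -[RHS](dist_set_rotation c n r 0 (2 * pi / n%:R)) addr0.
  by rewrite /shape ngon_shift.
Qed.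

Lemma eq_mule_fin n (X : \bar R) (c : R) : (0 < n)%N ->
  (n%:R%:E * X = c%:E -> X = (c / n%:R)%R%:E)%E.
Proof.
move=> n0; have nr : 0 < n%:R :> R by rewrite ltr0n.
case: X => [x| |]; last 2 first.
- by rewrite mulry gtr0_sg// mul1e.
- by rewrite mulrNy gtr0_sg// mul1e.
by rewrite -EFinM => -[<-]; congr (_%:E); field; rewrite gt_eqF.
Qed.

Lemma integral_sector_cost n r : (1 < n)%N -> 0 <= r ->
  (\int[P]_(x in sector n) (x.1 ^+ 2 + x.2 ^+ 2 + r ^+ 2 - 2 * r * x.1)%R%:E =
   ((1 / 2 + r ^+ 2) / n%:R - 4 * r * sin (pi / n%:R) / (3 * pi))%R%:E)%E.
Proof.
move=> n1 r0; have n0 := ltnW n1; have mS := measurable_sector (R := R) n.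
have mq := @measurable_sq_norm R.
have mq2 : measurable_fun setT (fun x : plane R => x.1 ^+ 2 + x.2 ^+ 2 + r ^+ 2).
  exact: measurable_funD.
have m1 : measurable_fun setT (fun x : plane R => 2 * r * x.1) by exact: measurable_funM.
have m2 : measurable_fun setT (fun x : plane R => 2 * r * `|x.1|).
  by apply: measurable_funM => //; exact: measurableT_comp.
(* This part of the cost is rotation invariant, so the sector receives the share [1 / n] of its
   total. *)
have h1 : (\int[P]_(x in sector n) (x.1 ^+ 2 + x.2 ^+ 2 + r ^+ 2)%R%:E =
    ((1 / 2 + r ^+ 2) / n%:R)%R%:E)%E.
  apply: eq_mule_fin => //; rewrite -(integral_sector P_uniform n1)//.
  - under eq_integral do rewrite EFinD.
    rewrite ge0_integralD//; last 3 first.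
    + by move=> x _; rewrite lee_fin addr_ge0// sqr_ge0.
    + exact/measurable_EFinP.
    + by move=> x _; rewrite lee_fin sqr_ge0.
    rewrite (uniform_disc_sqr_norm P_uniform).
    rewrite (_ : \int[P]_x (r ^+ 2)%:E = (r ^+ 2)%:E)%E; last first.
      transitivity (\int[P]_x cst (r ^+ 2)%:E x)%E; first by [].
      by rewrite integral_cst// [X in (_ * X)%E](probability_setT P) mule1.
    by rewrite -EFinD div1r.
  - exact/measurable_EFinP.
  - by move=> x; rewrite lee_fin !addr_ge0// sqr_ge0.
  - by move=> x; rewrite sqnorm_rotation.
have h2 : (\int[P]_(x in sector n) (2 * r * `|x.1|)%R%:E =
    (4 * r * sin (pi / n%:R) / (3 * pi))%R%:E)%E.
  under eq_integral do rewrite EFinM.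
  have r20 : (0 <= (2 * r)%R%:E)%E by rewrite lee_fin mulr_ge0.
  have mn : measurable_fun (sector n) (fun x : plane R => `|x.1|%:E).
    by apply/measurable_EFinP; apply: measurable_funTS; exact: measurableT_comp.
  rewrite ge0_integralZl//.
  rewrite integral_sector_fst// -EFinM; congr (_%:E).
  by move: (pi) (pi_gt0 R) => p p0; field; rewrite gt_eqF.
set I := integral _ _ _.
have : (I + \int[P]_(x in sector n) (2 * r * `|x.1|)%R%:E =
    \int[P]_(x in sector n) (x.1 ^+ 2 + x.2 ^+ 2 + r ^+ 2)%R%:E)%E.
  rewrite /I -ge0_integralD//; last 4 first.
  - move=> x /(sector_fst_ge0 n1) x0; rewrite lee_fin.
    (* The cost equals [(x.1 - r)^2 + x.2^2]. *)
    by have := sqr_ge0 (x.1 - r); have := sqr_ge0 x.2; nra.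
  - by apply: measurable_funTS; apply/measurable_EFinP; exact: measurable_funB.
  - by move=> x _; rewrite lee_fin !mulr_ge0.
  - by apply: measurable_funTS; exact/measurable_EFinP.
  apply: eq_integral => x; rewrite inE => /(sector_fst_ge0 n1) x0.
  by rewrite ger0_norm// -EFinD; congr (_%:E); ring.
rewrite h1 h2; case: I => [i| |]// [e]; congr (_%:E).
by rewrite -e; ring.
Qed.

Lemma distortion_ngon n r t : (1 < n)%N -> 0 <= r ->
  distortion P (ngon n (0, 0) r t) =
  (1 / 2 + r ^+ 2 - 4 * n%:R * sin (pi / n%:R) / (3 * pi) * r)%:E.
Proof.
move=> n1 r0; rewrite -(set0U (ngon _ _ _ _)) (distortion_shape_sector false)//.
rewrite (_ : \int[P]_(x in _) _ =
  ((1 / 2 + r ^+ 2) / n%:R - 4 * r * sin (pi / n%:R) / (3 * pi))%R%:E)%E.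
  rewrite -EFinM; congr (_%:E).
  have nr : n%:R != 0 :> R by rewrite pnatr_eq0 -lt0n ltnW.
  by move: (sin _) => s; move: (pi) (pi_gt0 R) => p p0; field; rewrite gt_eqF.
rewrite -integral_sector_cost//; apply: eq_integral => x; rewrite inE => xS.
exact: dist_set_ngon_sector.
Qed.

(** The saving due to the origin is the triangle integral at [a = r / 2]; the upper bound on [r] is
    its condition [a <= cos (pi / n)]. *)
Lemma distortion_centered n r t : (2 < n)%N -> 0 < r <= 2 * cos (pi / n%:R) ->
  distortion P (origin `|` ngon n (0, 0) r t) =
  (1 / 2 + r ^+ 2 - 4 * n%:R * sin (pi / n%:R) / (3 * pi) * r
   - n%:R * tan (pi / n%:R) / (12 * pi) * r ^+ 4)%:E.
Proof.
move=> n2 /andP[r0 rc]; have n1 := ltnW n2.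
rewrite (distortion_shape_sector true)//; set I := integral _ _ _.
have mS := measurable_sector (R := R) n.
have mm : measurable_fun setT (fun x : plane R => Num.max (r / 2 - x.1) 0).
  by apply: measurable_maxr => //; exact: measurable_funB.
have M0 (x : R) : 0 <= Num.max (r / 2 - x) 0 by rewrite le_max lexx orbT.
have h : (\int[P]_(x in sector n) (2 * r * Num.max (r / 2 - x.1) 0)%R%:E =
    (2 * r * (tan (pi / n%:R) * (r / 2) ^+ 3 / (3 * pi)))%R%:E)%E.
  under eq_integral do rewrite EFinM.
  have r20 : (0 <= (2 * r)%R%:E)%E by rewrite lee_fin mulr_ge0// ltW.
  have mn : measurable_fun (sector n) (fun x : plane R => (Num.max (r / 2 - x.1) 0)%:E).
    by apply/measurable_EFinP; exact: measurable_funTS.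
  have n0 (x : plane R) : (0 <= (Num.max (r / 2 - x.1) 0)%R%:E)%E by rewrite lee_fin.
  rewrite ge0_integralZl//.
  rewrite integral_sector_triangle// divr_ge0 ?(ltW r0)//=; lra.
have : (I + \int[P]_(x in sector n) (2 * r * Num.max (r / 2 - x.1) 0)%R%:E =
    ((1 / 2 + r ^+ 2) / n%:R - 4 * r * sin (pi / n%:R) / (3 * pi))%R%:E)%E.
  rewrite -(integral_sector_cost n1 (ltW r0)) /I -ge0_integralD//; last 4 first.
  - by move=> x _; exact: dist_set_ge0.
  - apply: measurable_funTS; apply: measurable_dist_set; first exact: finite_shape.
    by apply: shape_neq0; exact: ltnW.
  - by move=> x _; rewrite lee_fin !mulr_ge0// ltW.
  - by apply: measurable_funTS; apply/measurable_EFinP; exact: measurable_funM.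
  apply: eq_integral => x; rewrite inE => xS.
  by rewrite /shape dist_set_centered_sector// ltW.
rewrite h; case: I => [i| |]// [e]; rewrite -EFinM; congr (_%:E).
have -> : i = (1 / 2 + r ^+ 2) / n%:R - 4 * r * sin (pi / n%:R) / (3 * pi) -
  2 * r * (tan (pi / n%:R) * (r / 2) ^+ 3 / (3 * pi)) by rewrite -e; ring.
have nr : n%:R != 0 :> R by rewrite pnatr_eq0 -lt0n ltnW// ltnW.
by move: (sin _) (tan _) => s u; move: (pi) (pi_gt0 R) => p p0; field; rewrite gt_eqF.
Qed.

(* On the disc every vertex is at distance at least 3/5 from the point, since [r >= 8/5]. *)
Lemma distortion_centered_far n r t : (0 < n)%N -> 8 / 5 <= r ->
  ((18 / 100)%R%:E <= distortion P (origin `|` ngon n (0, 0) r t)%R)%E.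
Proof.
move=> n0 r0.
(* The second moment is [1 / 2], so it suffices to bound the squared distance below by [36 / 100]
   times the squared norm. *)
have -> : (18 / 100)%R%:E = (\int[P]_x (36 / 100 * (x.1 ^+ 2 + x.2 ^+ 2))%R%:E)%E.
  under eq_integral do rewrite EFinM.
  have mn : measurable_fun setT (fun x : plane R => (x.1 ^+ 2 + x.2 ^+ 2)%:E).
    by apply/measurable_EFinP; exact: measurable_sq_norm.
  have n1 (x : plane R) : (0 <= (x.1 ^+ 2 + x.2 ^+ 2)%R%:E)%E.
    by rewrite lee_fin addr_ge0// sqr_ge0.
  rewrite ge0_integralZl//.
  by rewrite (uniform_disc_sqr_norm P_uniform) -EFinM; congr (_%:E); field.
have mD : measurable (@unit_disc R : set (plane R)) := measurable_unit_disc.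
have md : measurable_fun setT (dist_set (origin `|` ngon n (0, 0) r t) : plane R -> \bar R).
  by apply: measurable_dist_set; [exact: (finite_shape true)|exact: (shape_neq0 true)].
have mq : measurable_fun setT
    (fun x : plane R => (36 / 100 * (x.1 ^+ 2 + x.2 ^+ 2))%:E).
  by apply/measurable_EFinP; apply: measurable_funM => //; exact: measurable_sq_norm.
have q0 (x : plane R) : (0 <= (36 / 100 * (x.1 ^+ 2 + x.2 ^+ 2))%R%:E)%E.
  by rewrite lee_fin mulr_ge0// addr_ge0// sqr_ge0.
rewrite distortionE (integral_setI_disc P_uniform)// [leRHS](integral_setI_disc P_uniform)//; last first.
  by move=> x; exact: dist_set_ge0.
rewrite setTI; apply: ge0_le_integral => //.
- exact: measurable_funTS.
- exact: measurable_funTS.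
- move=> x; rewrite /unit_disc/= => xD; apply: dist_set_ge => _ [->|[k kn <-]].
    by rewrite /sqdist/= !subr0; have := sqr_ge0 x.1; have := sqr_ge0 x.2; lra.
  rewrite sqdist_polar; set b := t + _.
  have cs := cos2Dsin2 b.
  have pb : dirproj b x ^+ 2 <= x.1 ^+ 2 + x.2 ^+ 2.
    have -> : x.1 ^+ 2 + x.2 ^+ 2 = dirproj b x ^+ 2 + (x.1 * sin b - x.2 * cos b) ^+ 2.
      transitivity ((x.1 ^+ 2 + x.2 ^+ 2) * (cos b ^+ 2 + sin b ^+ 2)).
        by rewrite cs mulr1.
      by rewrite /dirproj; ring.
    by rewrite lerDl sqr_ge0.
  move: pb xD; set q := x.1 ^+ 2 + _; set p := dirproj b x => pb xD.
  have p1 : p <= 1 by nra.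
  (* Since [q >= p^2], it is enough that [16/25 p^2 - 2 r p + r^2 >= 0], and this is [16/25] times
     the product; both factors are nonnegative as [p <= 1 <= 5 r / 8]. *)
  have : 0 <= (5 / 8 * r - p) * (5 / 2 * r - p) by rewrite mulr_ge0//; lra.
  nra.
Qed.

End distortion_ngon.

(** * Bounds on pi *)

Section pi_bounds.
Context {R : realType}.
Implicit Types x : R.

Lemma nonneg_derive_ge0 (f f' : R -> R) x : 0 <= x ->
  (forall t : R, is_derive t 1 f (f' t)) -> (forall t, 0 <= t -> 0 <= f' t) ->
  f 0 = 0 -> 0 <= f x.
Proof.
move=> x0 df f'0 f0; move: x0; rewrite le_eqVlt => /orP[/eqP <-|x0].
  by rewrite f0.
have [c /[!in_itv]/= /andP[c0 _]] := @MVT _ f f' 0 x x0 (fun t _ => df t)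
  (derivable_within_continuous (fun t _ => @ex_derive _ _ _ _ _ _ _ (df t))).
by rewrite f0 !subr0 => ->; rewrite mulr_ge0 ?f'0 ?ltW.
Qed.

Definition atan_lo x : R :=
  x - x ^+ 3 / 3 + x ^+ 5 / 5 - x ^+ 7 / 7 + x ^+ 9 / 9 - x ^+ 11 / 11.
Definition atan_hi x : R := atan_lo x + x ^+ 13 / 13.

(** The derivative of the difference is the remainder [t^12 / (1 + t^2)] of a geometric series. *)
Lemma atan_lo_le x : 0 <= x -> atan_lo x <= atan x.
Proof.
move=> x0; rewrite -subr_ge0.
apply: (@nonneg_derive_ge0 (fun x => atan x - atan_lo x)
  (fun x => (1 + x ^+ 2)^-1 - (1 - x ^+ 2 + x ^+ 4 - x ^+ 6 + x ^+ 8 - x ^+ 10))) => //.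
- move=> t; rewrite /atan_lo; apply: is_derive_eq; rewrite /GRing.scale/=.
  by congr (_ - _); field.
- move=> t t0; have p : 0 < 1 + t ^+ 2 by rewrite ltr_pwDl// sqr_ge0.
  rewrite (_ : _ - _ = t ^+ 12 / (1 + t ^+ 2)); last by field; rewrite gt_eqF.
  by rewrite divr_ge0 ?exprn_ge0// ltW.
- by rewrite /atan_lo atan0; ring.
Qed.

Lemma atan_hi_ge x : 0 <= x -> atan x <= atan_hi x.
Proof.
move=> x0; rewrite -subr_ge0.
apply: (@nonneg_derive_ge0 (fun x => atan_hi x - atan x)
  (fun x => (1 - x ^+ 2 + x ^+ 4 - x ^+ 6 + x ^+ 8 - x ^+ 10 + x ^+ 12) - (1 + x ^+ 2)^-1)) => //.
- move=> t; rewrite /atan_hi /atan_lo; apply: is_derive_eq; rewrite /GRing.scale/=.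
  by congr (_ - _); field.
- move=> t t0; have p : 0 < 1 + t ^+ 2 by rewrite ltr_pwDl// sqr_ge0.
  rewrite (_ : _ - _ = t ^+ 14 / (1 + t ^+ 2)); last by field; rewrite gt_eqF.
  by rewrite divr_ge0 ?exprn_ge0// ltW.
- by rewrite /atan_hi /atan_lo atan0; ring.
Qed.

Lemma cos_atan_gt0 x : 0 < cos (atan x).
Proof. by apply: cos_gt0_pihalf; rewrite atan_gtNpi2 atan_ltpi2. Qed.

Lemma sin_atanE x : sin (atan x) = x * cos (atan x).
Proof. by rewrite -{2}(atanK x) /tan divfK// gt_eqF// cos_atan_gt0. Qed.

(** Addition formulas give [4 a] the tangent [120 / 119], hence [4 a - b] the tangent 1. The crude
    bounds on [a] and [b] place [4 a - b] where the tangent is injective. *)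
Lemma machin : pi / 4 = 4 * atan 5^-1 - atan 239^-1 :> R.
Proof.
set a := atan 5^-1; set b := atan 239^-1.
have sa : sin a = 5^-1 * cos a by exact: sin_atanE.
have sb : sin b = 239^-1 * cos b by exact: sin_atanE.
have ca : 0 < cos a by exact: cos_atan_gt0.
have cb : 0 < cos b by exact: cos_atan_gt0.
have a0 : 0 < a by rewrite /a -(@atan0 R); apply: lt_atan; lra.
have b0 : 0 < b by rewrite /b -(@atan0 R); apply: lt_atan; lra.
have a1 : a < pi / 4 by rewrite /a -atan1; apply: lt_atan; lra.
have hi : a <= 5^-1.
  have := @atan_hi_ge 5^-1; rewrite /atan_hi /atan_lo => h.
  by rewrite (le_trans (h _))//; lra.
have hib : b <= 239^-1.
  have := @atan_hi_ge 239^-1; rewrite /atan_hi /atan_lo => h.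
  by rewrite (le_trans (h _))//; lra.
have p2 := @pi_ge2 R.
have c2 : cos (a + a) = (1 - 5^-1 ^+ 2) * cos a ^+ 2.
  by rewrite cosD sa; ring.
have s2 : sin (a + a) = 2 * 5^-1 * cos a ^+ 2 by rewrite sinD sa; ring.
have c4 : cos ((a + a) + (a + a)) = 119 / 120 * sin ((a + a) + (a + a)).
  by rewrite (cosD (a + a)) (sinD (a + a)) c2 s2; field.
have e : sin ((a + a) + (a + a) - b) = cos ((a + a) + (a + a) - b).
  by rewrite sinB cosB sb c4; field.
set t := 4 * a - b.
have {}e : sin t = cos t by rewrite /t (_ : 4 * a = (a + a) + (a + a))//; ring.
have t1 : - (pi / 2) < t < pi / 2 by apply/andP; split; rewrite /t; lra.
have ct : 0 < cos t by exact: cos_gt0_pihalf.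
have : tan t = tan (pi / 4) by rewrite tan_piquarter /tan e divff// gt_eqF.
move/tan_inj => <-//; rewrite in_itv/=; apply/andP; split; lra.
Qed.

(** The two bounds for [atan 5^-1] differ by [5^-13 / 13]; multiplied by 16 this is about [10^-9],
    which is enough for eight decimals. *)
Lemma pi_bounds : 3 + 141 / 10 ^+ 3 + 592 / 10 ^+ 6 + 65 / 10 ^+ 8 < (pi : R) <
    3 + 141 / 10 ^+ 3 + 592 / 10 ^+ 6 + 66 / 10 ^+ 8.
Proof.
have := machin.
have := @atan_lo_le 5^-1; have := @atan_hi_ge 5^-1.
have := @atan_lo_le 239^-1; have := @atan_hi_ge 239^-1.
rewrite /atan_hi /atan_lo.
move: (atan 5^-1) (atan 239^-1) => a b.
rewrite !invr_ge0 !ler0n => /(_ isT) h1 /(_ isT) h2 /(_ isT) h3 /(_ isT) h4 h.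
apply/andP; split; lra.
Qed.

End pi_bounds.

(** * The optimal pentagon *)

Section pentagon_constants.
Context {R : realType}.
Implicit Types x : R.

Lemma sin_add3 x : sin (x + x + x) = sin x * (4 * cos x ^+ 2 - 1).
Proof.
rewrite (sinD (x + x)) sinD cosD.
transitivity (sin x * (3 * cos x ^+ 2 - sin x ^+ 2)); first by ring.
by rewrite sin2cos2; ring.
Qed.

(** The triple angle formula at [pi / 2] becomes [(s + 1) (2 s - 1)^2 = 0] for
    [s = sin (pi / 6)]. *)
Lemma sin_pi6 : sin (pi / 6) = 1 / 2 :> R.
Proof.
set x : R := pi / 6.
have p0 := pi_gt0 R.
have s0 : 0 < sin x by apply: sin_gt0_pi; rewrite /x; apply/andP; split; lra.
have : sin (x + x + x) = 1.
  by rewrite -sin_pihalf; congr sin; rewrite /x; field.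
have c2 : cos x ^+ 2 = 1 - sin x ^+ 2 by rewrite -(cos2Dsin2 x); ring.
rewrite sin_add3 c2 => e.
have : (sin x + 1) * (2 * sin x - 1) ^+ 2 = 0.
  transitivity (1 - sin x * (4 * (1 - sin x ^+ 2) - 1)); first by ring.
  by rewrite e subrr.
move=> /eqP; rewrite mulf_eq0 sqrf_eq0 => /orP[|] /eqP; lra.
Qed.

(** For [x = pi / 5] one has [sin (3 x) = sin (pi - 2 x) = sin (2 x)]; dividing by [sin x] leaves
    the quadratic. *)
Lemma cos_pi5_root : 4 * cos (pi / 5) ^+ 2 - 2 * cos (pi / 5) - 1 = 0 :> R.
Proof.
set x : R := pi / 5; have p0 := pi_gt0 R.
have s0 : 0 < sin x by apply: sin_gt0_pi; rewrite /x; apply/andP; split; lra.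
have : sin (x + x + x) = sin (x + x).
  have -> : x + x + x = pi - (x + x) by rewrite /x; field.
  by rewrite sinB sinpi cospi; ring.
rewrite sin_add3 sinD => e; apply: (mulfI (lt0r_neq0 s0)).
transitivity (sin x * (4 * cos x ^+ 2 - 1) - (sin x * cos x + cos x * sin x)).
  by ring.
by rewrite e subrr mulr0.
Qed.

Lemma cos_pi5_bounds :
  809 / 10 ^+ 3 + 16 / 10 ^+ 6 + 99 / 10 ^+ 8 < cos (pi / 5 : R) < 809 / 10 ^+ 3 + 17 / 10 ^+ 6.
Proof.
have p0 := pi_gt0 R.
have c0 : 0 < cos (pi / 5 : R) by apply: cos_gt0_pihalf; apply/andP; split; lra.
have := cos_pi5_root; move: (cos _) c0 => c c0 e; apply/andP; split; nra.
Qed.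

Lemma sin_pi5_bounds :
  587 / 10 ^+ 3 + 785 / 10 ^+ 6 + 24 / 10 ^+ 8 < sin (pi / 5 : R) <
    587 / 10 ^+ 3 + 785 / 10 ^+ 6 + 26 / 10 ^+ 8.
Proof.
have p0 := pi_gt0 R.
have s0 : 0 < sin (pi / 5 : R) by apply: sin_gt0_pi; apply/andP; split; lra.
have := cos_pi5_bounds; have := sin2cos2 (pi / 5 : R).
move: (sin _) (cos _) s0 => s c s0 e /andP[c1 c2]; apply/andP; split; nra.
Qed.

(* The distortion of the origin together with a regular pentagon of radius r
   is [1 / 2 + r ^+ 2 - lin_coef * r - quart_coef * r ^+ 4]. *)
Definition lin_coef : R := 4 * 5%:R * sin (pi / 5%:R) / (3 * pi).
Definition quart_coef : R := 5%:R * tan (pi / 5%:R) / (12 * pi).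

Lemma lin_coef_bounds :
  1 + 247 / 10 ^+ 3 + 318 / 10 ^+ 6 + 9 / 10 ^+ 7 < lin_coef <
    1 + 247 / 10 ^+ 3 + 319 / 10 ^+ 6 + 2 / 10 ^+ 7.
Proof.
have := @pi_bounds R; have := sin_pi5_bounds; rewrite /lin_coef.
move: (sin _) => s; move: (pi) => p /andP[s1 s2] /andP[p1 p2].
have p0 : 0 < 3 * p by lra.
by rewrite ltr_pdivlMr// ltr_pdivrMr//; apply/andP; split; lra.
Qed.

Lemma quart_coef_bounds :
  96 / 10 ^+ 3 + 360 / 10 ^+ 6 + 6 / 10 ^+ 7 < quart_coef <
    96 / 10 ^+ 3 + 360 / 10 ^+ 6 + 8 / 10 ^+ 7.
Proof.
have := @pi_bounds R; have := sin_pi5_bounds; have := cos_pi5_bounds.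
rewrite /quart_coef /tan.
move: (sin _) (cos _) => s c; move: (pi) => p /andP[c1 c2] /andP[s1 s2] /andP[p1 p2].
have c0 : 0 < c by lra.
have p0 : 0 < p by lra.
have -> : 5 * (s / c) / (12 * p) = 5 * s / (12 * (p * c)).
  by field; rewrite !gt_eqF.
have pc0 : 0 < 12 * (p * c) by rewrite mulr_gt0// mulr_gt0.
(* Bounding the product [p * c] first leaves inequalities that are linear in [s] and [p * c]. *)
have z1 : (3 + 141 / 10 ^+ 3 + 592 / 10 ^+ 6 + 65 / 10 ^+ 8) *
    (809 / 10 ^+ 3 + 16 / 10 ^+ 6 + 99 / 10 ^+ 8) < p * c.
  by apply: (ltr_pM _ _ p1 c1); lra.
have z2 : p * c < (3 + 141 / 10 ^+ 3 + 592 / 10 ^+ 6 + 66 / 10 ^+ 8) *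
    (809 / 10 ^+ 3 + 17 / 10 ^+ 6).
  by apply: (ltr_pM _ _ p2 c2); exact: ltW.
move: (p * c) pc0 z1 z2 => z pc0 z1 z2.
by rewrite ltr_pdivlMr// ltr_pdivrMr//; apply/andP; split; lra.
Qed.

Definition pentagon_distortion (r : R) : R :=
  1 / 2 + r ^+ 2 - lin_coef * r - quart_coef * r ^+ 4.

Lemma critical_radius_exists : exists r : R,
  [/\ 685 / 10 ^+ 3 + 828 / 10 ^+ 6 + 7 / 10 ^+ 7 <= r,
      r <= 685 / 10 ^+ 3 + 829 / 10 ^+ 6 + 3 / 10 ^+ 7 &
      2 * r = lin_coef + 4 * quart_coef * r ^+ 3].
Proof.
have /andP[L1 L2] := lin_coef_bounds; have /andP[Q1 Q2] := quart_coef_bounds.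
set a : R := _ + 7 / _; set b : R := _ + 3 / _.
(* This is the derivative of [pentagon_distortion]; it changes sign between [a] and [b]. *)
pose p : {poly R} := 2%:P * 'X - lin_coef%:P - (4 * quart_coef)%:P * 'X^3.
have pE r : p.[r] = 2 * r - lin_coef - 4 * quart_coef * r ^+ 3.
  by rewrite /p !hornerE.
have [||r /andP[ar rb] /rootP] := @poly_ivt _ p a b.
- by rewrite /a /b; lra.
- by rewrite !pE /a /b; apply/andP; split; nra.
by rewrite pE => e; exists r; split => //; lra.
Qed.

Lemma pentagon_distortion_sub (r u : R) :
  2 * u = lin_coef + 4 * quart_coef * u ^+ 3 ->
  pentagon_distortion r - pentagon_distortion u =
  (r - u) ^+ 2 * (1 - quart_coef * (r ^+ 2 + 2 * r * u + 3 * u ^+ 2)).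
Proof.
move=> e; rewrite /pentagon_distortion.
have -> : lin_coef = 2 * u - 4 * quart_coef * u ^+ 3 by rewrite e; ring.
by ring.
Qed.

Lemma pentagon_distortion_min (r u : R) :
  2 * u = lin_coef + 4 * quart_coef * u ^+ 3 -> 0 < u <= 7 / 10 -> 0 < r <= 8 / 5 ->
  pentagon_distortion r <= pentagon_distortion u -> r = u.
Proof.
move=> e /andP[u0 u1] /andP[r0 r1]; rewrite -subr_le0 (pentagon_distortion_sub _ e).
have /andP[Q1 Q2] := quart_coef_bounds.
set k := 1 - _; have k0 : 0 < k.
  (* At [r = 8/5] and [u = 7/10] the left side is 6.27, and [7 * quart_coef] is still below 1. *)
  have : r ^+ 2 + 2 * r * u + 3 * u ^+ 2 <= 7 by nra.
  by rewrite /k; move: (r ^+ 2 + _ + _) => y y7; nra.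
rewrite pmulr_lle0// => h; apply/eqP; rewrite -subr_eq0 -sqrf_eq0.
by rewrite eq_le h sqr_ge0.
Qed.

Lemma pentagon_distortion_bounds (u : R) :
  2 * u = lin_coef + 4 * quart_coef * u ^+ 3 ->
  685 / 10 ^+ 3 + 828 / 10 ^+ 6 + 7 / 10 ^+ 7 <= u ->
  u <= 685 / 10 ^+ 3 + 829 / 10 ^+ 6 + 3 / 10 ^+ 7 ->
  [/\ `|u ^+ 2 - 470361%:R / 10 ^+ 6| < 10 ^- 6 &
      `|pentagon_distortion u - 93595%:R / 10 ^+ 6| < 10 ^- 6].
Proof.
move=> e u1 u2; have /andP[Q1 Q2] := quart_coef_bounds.
have sq (a b : R) : 0 <= a -> a <= b -> a ^+ 2 <= b ^+ 2.
  by clear; nra.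
have lo0 : 0 <= 685 / 10 ^+ 3 + 828 / 10 ^+ 6 + 7 / 10 ^+ 7 :> R by clear; lra.
have y1 := sq _ _ lo0 u1.
have y2 := sq _ _ (le_trans lo0 u1) u2.
(* Eliminating [lin_coef] by the critical equation leaves an expression linear in [u^2] and
   [quart_coef * u^4], which are bounded separately. *)
have -> : pentagon_distortion u = 1 / 2 - u ^+ 2 + 3 * quart_coef * (u ^+ 2) ^+ 2.
  rewrite /pentagon_distortion.
  have -> : lin_coef = 2 * u - 4 * quart_coef * u ^+ 3 by rewrite e; ring.
  by field.
move: (u ^+ 2) y1 y2 => y y1 y2 {u1 u2 e}.
have z1 := sq _ _ (sqr_ge0 _) y1.
have z2 := sq _ _ (le_trans (sqr_ge0 _) y1) y2.
have q0 : 0 <= 96 / 10 ^+ 3 + 360 / 10 ^+ 6 + 6 / 10 ^+ 7 :> R by clear; lra.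
have w1 := ler_pM q0 (sqr_ge0 _) (ltW Q1) z1.
have w2 := ler_pM (le_trans q0 (ltW Q1)) (sqr_ge0 _) (ltW Q2) z2.
rewrite -mulrA; move: (quart_coef * y ^+ 2) w1 w2 => w w1 w2 {sq lo0 q0 z1 z2 Q1 Q2}.
by split; rewrite ltr_norml; apply/andP; split; lra.
Qed.

End pentagon_constants.

(** * Optimal sets of six-means *)

Section six_means.
Context {R : realType} (P : probability (plane R) R).
Hypothesis P_uniform : is_uniform_disc P.

Lemma centered_pentagon_card (r t : R) :
  (origin `|` ngon 5 (0, 0) r t #<= `I_6)%card.
Proof.
pose v k : R * R := if k is k'.+1 then
  (0 + r * cos (t + 2 * pi * k'%:R / 5%:R), 0 + r * sin (t + 2 * pi * k'%:R / 5%:R))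
  else (0, 0).
apply: card_le_trans (card_image_II v 6); apply: subset_card_le.
move=> _ [->|[k k5 <-]]; first by exists 0%N.
by exists k.+1.
Qed.

Lemma distortion_pentagon (r t : R) : 0 < r <= 8 / 5 ->
  distortion P (origin `|` ngon 5 (0, 0) r t) = (pentagon_distortion r)%:E.
Proof.
move=> /andP[r0 r1]; rewrite (distortion_centered P_uniform)//.
by have := @cos_pi5_bounds R; move=> /andP[c1 _]; apply/andP; split => //; lra.
Qed.

Lemma distortion_hexagon_ge (r t : R) : 0 <= r ->
  ((94 / 1000)%R%:E < distortion P (ngon 6 (0, 0) r t)%R)%E.
Proof.
move=> r0; rewrite (distortion_ngon P_uniform)// lte_fin sin_pi6.
have := @pi_bounds R => /andP[p1 _].
have p0 : 3 < pi :> R by lra.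
have pp : 0 < pi :> R by exact: pi_gt0.
move: (pi) p1 p0 pp => p p1 p0 pp.
have -> : 4 * 6 * (1 / 2) / (3 * p) = 4 / p :> R by field; rewrite gt_eqF.
have k0 : 0 < 4 / p :> R by rewrite divr_gt0.
have ck : 4 / p * p = 4 by rewrite divfK// gt_eqF.
have p3 : 3 + 141 / 1000 < p by move: p1; clear; lra.
move: (4 / p) ck k0 => c ck k0.
(* The minimum over [r] is [1/2 - c^2 / 4], at least 0.0942 under this bound. *)
have c1 : c <= 1 + 274 / 1000.
  by move: ck p3 k0; clear; nra.
have := sqr_ge0 (r - c / 2).
by move: c1 k0; clear; nra.
Qed.

(** If [S] were countable, so would be the union of its members; yet the first coordinates of that
    union contain [[0, r]], which has positive measure. *)
Lemma uncountable_centered_pentagons (r : R) (S : set (set (R * R))) : 0 < r ->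
  (forall t, S (origin `|` ngon 5 (0, 0) r t)) ->
  (forall alpha, S alpha -> countable alpha) -> ~ countable S.
Proof.
move=> r0 Sr Sc cS.
have cU : countable (fst @` \bigcup_(alpha in S) alpha).
  apply: sub_countable (card_image_le _ _) _.
  exact: bigcup_countable.
have sub : `[0, r]%classic `<=` fst @` \bigcup_(alpha in S) alpha.
  move=> x /=; rewrite in_itv/= => /andP[x0 x1].
  have h : -1 <= x / r <= 1.
    rewrite ler_pdivrMr// mul1r x1 andbT (@le_trans _ _ 0)//.
    by rewrite divr_ge0// ltW.
  (* The phase [acos (x / r)] gives the first vertex abscissa [x]. *)
  exists (0 + r * cos (acos (x / r) + 2 * pi * 0%:R / 5%:R),
          0 + r * sin (acos (x / r) + 2 * pi * 0%:R / 5%:R)).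
    by exists (origin `|` ngon 5 (0, 0) r (acos (x / r))) => //; right; exists 0%N.
  by rewrite /= mulr0 mul0r addr0 add0r acosK ?in_itv//= mulrC divfK// gt_eqF.
have := countable_lebesgue_measure0 (sub_countable (subset_card_le sub) cU).
rewrite lebesgue_measure_itv/= lte_fin r0 -EFinB subr0 => -[e].
by move: r0; rewrite e ltxx.
Qed.

End six_means.

Unset Implicit Arguments.
Set Strict Implicit.

Theorem theorem2p11p1 (R : realType) (P : probability (plane R) R)
  (P_uniform : is_uniform_disc P)
  (optimal_shape : forall alpha : set (R * R), optimal_means P 6 alpha ->
     regular_ngon_centered 6 (0, 0) alpha \/
     (exists B : set (R * R),
        regular_ngon_centered 5 (0, 0) B /\ alpha = [set (0, 0)] `|` B)) :
  ~ countable [set alpha : set (R * R) | optimal_means P 6 alpha] /\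
  (`|quantization_error P 6 - (93595%:R / 10 ^+ 6)%:E| < (10 ^- 6)%:E)%E /\
  exists c : R, `|c - 470361%:R / 10 ^+ 6| < 10 ^- 6 /\
    forall alpha : set (R * R), optimal_means P 6 alpha ->
      exists B : set (R * R),
        [/\ alpha = [set (0, 0)] `|` B, regular_ngon 5 B & B `<=` circle_sq c].
Proof.
have [u [u1 u2 eu]] := @critical_radius_exists R.
have [u2c uV] := pentagon_distortion_bounds eu u1 u2.
have u0 : 0 < u by move: u1; clear; lra.
have u7 : u <= 7 / 10 by move: u2; clear; lra.
have u8 : 0 < u <= 8 / 5 by apply/andP; split => //; move: u7; clear; lra.
have fu : pentagon_distortion u < 94 / 1000.
  by move: uV; rewrite ltr_norml => /andP[_]; clear; lra.
have Vle : (quantization_error P 6 <= (pentagon_distortion u)%:E)%E.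
  rewrite -(distortion_pentagon P_uniform 0 u8); apply: ereal_inf_lbound.
  by exists (origin `|` ngon 5 (0, 0) u 0) => //; exact: centered_pentagon_card.
(* The hexagon and a pentagon with [r > 8/5] both cost more than the bound [Vle]; the remaining
   pentagons are settled by uniqueness of the minimiser. *)
have opt alpha : optimal_means P 6 alpha ->
    exists t, alpha = origin `|` ngon 5 (0, 0) u t.
  move=> oa; have [_ Va] := oa.
  case: (optimal_shape _ oa) => [[r [t [r0 ae]]]|[B [[r [t [r0 Be]]] ae]]].
    have := distortion_hexagon_ge P_uniform t (ltW r0).
    rewrite -ae Va => /lt_le_trans/(_ Vle); rewrite lte_fin => h.
    by exfalso; move: fu h; clear; lra.
  move: Vle; rewrite -Va ae Be.
  have [r8|r8] := leP r (8 / 5).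
    rewrite (distortion_pentagon P_uniform)// ?r0// lee_fin => fr.
    exists t; rewrite (pentagon_distortion_min eu _ _ fr)// ?r0//.
    by rewrite u0.
  have := distortion_centered_far P_uniform t (ltn0Sn 4) (ltW r8).
  move=> /le_trans h /h; rewrite lee_fin => h2.
  by exfalso; move: fu h2; clear; lra.
(* So far the quantization error is only bounded above; an actual optimal set turns this into an
   equality. *)
have [alpha oa] := optimal_means_exist P_uniform (ltn0Sn 5).
have VE : quantization_error P 6 = (pentagon_distortion u)%:E.
  have [t ae] := opt _ oa; have [_ <-] := oa.
  by rewrite ae (distortion_pentagon P_uniform).
split; first last.
  split; first by rewrite VE; exact: uV.
  exists (u ^+ 2); split; first exact: u2c.
  move=> beta /opt[t ->].
  exists (ngon 5 (0, 0) u t); split => //.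
    by exists (0, 0), u, t.
  move=> _ [k _ <-]; rewrite /circle_sq/= !add0r !exprMn -mulrDr cos2Dsin2.
  by rewrite mulr1.
apply: (@uncountable_centered_pentagons R u) => //.
  (* The distortion does not depend on the phase, so every [t] gives an optimal set. *)
  move=> t; split; first exact: centered_pentagon_card.
  by rewrite VE (distortion_pentagon P_uniform).
by move=> beta [cb _]; apply/finite_set_countable/(card_le_finite cb)/finite_II.
Qed.
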